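(* For $0\le k\le d-2$, the $k$-th Grassmann angle valuation $G_k$ on $\mathcal P(\mathbb Z^d)$ is not combinatorially positive.
   Context: $\mathcal P(\mathbb Z^d)$ is the set of all convex lattice polytopes in $\mathbb R^d$ (convex hulls of finitely many points of $\mathbb Z^d$), including the empty set; $\dim P$ is the dimension of the affine hull of $P$. A function $\varphi:\mathcal P(\mathbb Z^d)\to\mathbb R$ is a valuation if $\varphi(\emptyset)=0$ and $\varphi(P\cup Q)=\varphi(P)+\varphi(Q)-\varphi(P\cap Q)$ whenever $P,Q,P\cup Q\in\mathcal P(\mathbb Z^d)$. It is translation-invariant if $\varphi(t+P)=\varphi(P)$ for all $t\in\mathbb Z^d$. For a translation-invariant valuation $\varphi$ on $\mathcal P(\mathbb Z^d)$ and a nonempty $P\in\mathcal P(\mathbb Z^d)$ with $\dim P=r$, the function $n\mapsto\varphi(nP)$ (where $nP=\{nu:u\in P\}$) agrees for positive integers $n$ with a polynomial $\varphi(tP)$ of degree at most $r$ (McMullen), which can be uniquely written as $$\varphi(tP)=h_0^\varphi(P)\binom{t+r}{r}+h_1^\varphi(P)\binom{t+r-1}{r}+\dots+h_r^\varphi(P)\binom tr.$$ The valuation $\varphi$ is called combinatorially positive if $h_i^\varphi(P)\ge0$ for all $P$ and all $0\le i\le\dim P$. For $v\in P$, the tangent cone is $T_v(P)=\operatorname{pos}(P-v)=\{\lambda(x-v):x\in P,\lambda\ge0\}$. Let $W_m$ be a random $m$-dimensional linear subspace of $\mathbb R^d$ distributed according to the rotation-invariant (Haar) probability measure on the Grassmannian,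 let $U$ be uniformly distributed on the unit sphere $\mathbb S^{d-1}$ independently of $W_m$, and let $W_m^+=W_m\cap\{x\in\mathbb R^d:\langle x,U\rangle\ge0\}$. For a convex cone $C\subseteq\mathbb R^d$ and $k\in\{0,\dots,d\}$, $\alpha_k(C)=\mathbb P[C\cap W_{d-k}^+\ne\{0\}]$. The $k$-th Grassmann angle valuation is $G_k(P)=\sum_{v\in P\cap\mathbb Z^d}\alpha_k(T_v(P))$; it is a translation-invariant valuation on $\mathcal P(\mathbb Z^d)$. *)

(* Defs.v *)
From HB Require Import structures.
From mathcomp Require Import all_boot all_order all_algebra.
From mathcomp Require Import all_classical all_reals all_analysis.

Set Implicit Arguments.
Unset Strict Implicit.
Unset Printing Implicit Defensive.

Import Order.TTheory GRing.Theory Num.Theory.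
Import numFieldNormedType.Exports.

Local Open Scope classical_set_scope.
Local Open Scope ring_scope.

(* Throughout, R^d is the type 'rV[R]_d of row vectors, so that linear maps act
   on the right and the row space of a matrix is a linear subspace of R^d. *)

Section LatticePolytopes.
Variables (R : realType) (d : nat).
Local Notation V := 'rV[R]_d.

Definition int_lattice : set V := [set v | forall j, v 0 j \is a Num.int].

Definition affine_hull (A : set V) : set V :=
  [set x | exists (n : nat) (s : 'I_n -> V) (c : 'I_n -> R),
    [/\ forall i, A (s i), \sum_i c i = 1 & x = \sum_i c i *: s i]].

Definition convex_hull (A : set V) : set V :=
  [set x | exists (n : nat) (s : 'I_n -> V) (c : 'I_n -> R),
    [/\ forall i, A (s i), forall i, 0 <= c i, \sum_i c i = 1
      & x = \sum_i c i *: s i]].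

Definition lattice_polytope (P : set V) : Prop :=
  exists A : set V,
    [/\ finite_set A, A `<=` int_lattice & P = convex_hull A].

(* Only nonempty sets have a dimension in this sense. *)
Definition has_dim (P : set V) (r : nat) : Prop :=
  exists (v : V) (L : {vspace V}),
    affine_hull P = [set v + w | w in [set w | w \in L]] /\ (\dim L)%VS = r.

Definition dilate (n : nat) (P : set V) : set V := [set n%:R *: u | u in P].

(* The polynomial binomial(t + a, r) in the indeterminate t. *)
Definition binomial_poly (a r : nat) : {poly R} :=
  (r`!%:R)^-1 *: \prod_(j < r) ('X + (a%:R - j%:R)%:P).

Definition is_dilation_poly (phi : set V -> R) (P : set V) (p : {poly R})
    : Prop :=
  forall n : nat, (0 < n)%N -> p.[n%:R] = phi (dilate n P).

Definition is_hvector (phi : set V -> R) (P : set V) (r : nat)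
    (h : 'I_r.+1 -> R) : Prop :=
  is_dilation_poly phi P (\sum_(i < r.+1) h i *: binomial_poly (r - i) r).

(* The h-vector of a nonempty lattice polytope with respect to a
   translation-invariant valuation exists and is unique, so quantifying over
   all h with is_hvector amounts to speaking of the h-vector. *)
Definition combinatorially_positive (phi : set V -> R) : Prop :=
  forall (P : set V) (r : nat) (h : 'I_r.+1 -> R),
    lattice_polytope P -> P !=set0 -> has_dim P r -> is_hvector phi P h ->
    forall i, 0 <= h i.

Definition tangent_cone (P : set V) (v : V) : set V :=
  [set y | exists x l, [/\ P x, 0 <= l & y = l *: (x - v)]].

End LatticePolytopes.

Section RandomSubspaces.
Variables (R : realType) (d : nat).
Local Notation V := 'rV[R]_d.

Definition dot (x y : V) : R := \sum_i x 0 i * y 0 i.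

Definition orthogonal_mx (Q : 'M[R]_d) : Prop := Q *m Q^T = 1%:M.

(* The Grassmannian of m-dimensional linear subspaces of R^d: a subspace is
   encoded by the matrix of the orthogonal projection onto it, which has that
   subspace as row space. The topology of the Grassmannian is the one induced
   from 'M[R]_d. *)
Definition grassmannian (m : nat) : set 'M[R]_d :=
  [set W | [/\ W^T = W, W *m W = W & \rank W = m]].

Definition unit_sphere : set V := [set u | dot u u = 1].

Definition half_subspace (W : 'M[R]_d) (u : V) : set V :=
  [set x | (x <= W)%MS /\ 0 <= dot x u].

Section Laws.
Variables (dO : measure_display) (Omega : measurableType dO).
Variable Pr : probability Omega R.

Definition borel_measurable (T : ptopologicalType) (X : Omega -> T) : Prop :=
  measurable_fun setT (X : Omega -> g_sigma_algebraType (@open T)).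

Definition same_law (T : ptopologicalType) (X Y : Omega -> T) : Prop :=
  forall A : set T, <<s @open T >> A -> Pr (X @^-1` A) = Pr (Y @^-1` A).

Definition independent (T S : ptopologicalType) (X : Omega -> T)
    (Y : Omega -> S) : Prop :=
  forall (A : set T) (B : set S), <<s @open T >> A -> <<s @open S >> B ->
    Pr ((X @^-1` A) `&` (Y @^-1` B)) = (Pr (X @^-1` A) * Pr (Y @^-1` B))%E.

(* The orthogonal map x |-> x *m Q sends the subspace with projection matrix W
   to the subspace with projection matrix Q^T *m W *m Q. *)
Definition haar_subspace (m : nat) (W : Omega -> 'M[R]_d) : Prop :=
  [/\ borel_measurable W, forall w, grassmannian m (W w)
    & forall Q, orthogonal_mx Q -> same_law (fun w => Q^T *m W w *m Q) W].

(* The uniform distribution on the sphere is its unique rotation-invariant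
   Borel probability measure. *)
Definition uniform_on_sphere (U : Omega -> V) : Prop :=
  [/\ borel_measurable U, forall w, unit_sphere (U w)
    & forall Q, orthogonal_mx Q -> same_law (fun w => U w *m Q) U].

Section Grassmann.
Variables (W : Omega -> 'M[R]_d) (U : Omega -> V).

(* When W is a Haar-random subspace of dimension d - k and U an independent
   uniform point of the sphere, these are the k-th Grassmann angle of the cone C
   and the k-th Grassmann angle valuation. *)
Definition grassmann_angle (C : set V) : R :=
  fine (Pr [set w | C `&` half_subspace (W w) (U w) <> [set 0]]).

Definition grassmann_valuation (P : set V) : R :=
  \sum_(v \in P `&` @int_lattice R d) grassmann_angle (tangent_cone P v).

End Grassmann.
End Laws.
End RandomSubspaces.

(* Main.v *)
(* Take for polytope the cube [0,1]^r in r = k + 2 of the coordinates. The tangent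
   cone at a lattice point of its n-th dilate is determined by a set I of tight
   coordinates and a choice of one sign for each of them. Almost surely the random
   half-subspace meets R^r in a half-plane in general position: the |I| coordinate
   lines cut it into |I| + 1 sectors, so exactly |I| + 1 of the 2^|I| sign cones
   are hit. Hence the angles of these cones sum to |I| + 1, and
     G_k(n P) = sum_I (n - 1)^(r - |I|) (|I| + 1) = n^r + r n^(r-1),
   so that evaluating this polynomial p at -1 gives
   h_r = (-1)^r p(-1) = 1 - r < 0. *)

Require Import Defs.
From HB Require Import structures.
From mathcomp Require Import all_boot all_order all_algebra.
From mathcomp Require Import all_classical all_reals all_analysis.
From mathcomp Require Import measurable_realfun.
From mathcomp Require Import ring lra zify.

Set Implicit Arguments.
Unset Strict Implicit.
Unset Printing Implicit Defensive.

Import Order.TTheory GRing.Theory Num.Theory.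
Import numFieldNormedType.Exports.

Local Open Scope classical_set_scope.
Local Open Scope ring_scope.

(** The choice [r = k + 2] makes the expected dimension [(d - k) + r - d] of the intersection equal
    to 2. No single angle is computed: only their sum over the choices of signs matters, and it is
    the expectation of a count that is almost surely constant. The difficulty lies in
    [almost surely], since the laws of [W] and [U] are given only through invariance under
    orthogonal matrices. Null sets come from a packing argument: if infinitely many events share one
    probability and no outcome lies in more than [d] of them, this probability is zero. Reflections
    give the equal probabilities; the moment curve gives the bounded overlap, because a hyperplane
    contains fewer than [d] of its points. General position consists of a condition on [W] alone and
    a condition tying [W] to [U]; independence reduces the latter to a fixed [W]. The cones are
    closed, so a ray on a common face hits both neighbours. This is consistent with the sector
    count: such a ray separates two sectors that are hit anyway. *)

Lemma big_subset_setD1 (T : finType) (R : Type) (idx : R) (op : Monoid.com_law idx)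
    (A : {set T}) (a : T) (F : {set T} -> R) : a \in A ->
  \big[op/idx]_(I : {set T} | I \subset A) F I =
  \big[op/idx]_(I : {set T} | I \subset A :\ a) op (F I) (F (a |: I)).
Proof.
move=> aA; rewrite (bigID (fun I : {set T} => a \in I)) /=.
rewrite (reindex_onto (fun I => a |: I) (fun I : {set T} => I :\ a)) /=; last first.
  by move=> I /andP[_]; exact: finset.setD1K.
rewrite (eq_bigl (fun I : {set T} => I \subset A :\ a)); last first.
  move=> I /=; rewrite finset.subUset finset.sub1set aA finset.setU11 andbT /=.
  rewrite finset.subsetD1; case: (boolP (I \subset A)) => //= _.
  by apply/eqP/idP => [<-|/finset.setU1K//]; rewrite !inE eqxx.
rewrite [X in op _ X](eq_bigl (fun I : {set T} => I \subset A :\ a)); last first.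
  by move=> I; rewrite finset.subsetD1.
by rewrite Monoid.mulmC big_split.
Qed.

(** The second sum is the derivative at [x = 1] of [x (x + y)^#|A|], the generating function of the
    subsets with weight [x^(#|I| + 1)]. One induction proves both identities because removing a
    point from [A] makes the first appear in the second. *)
Lemma sum_subset_expr (R : comRingType) (T : finType) (A : {set T}) (y : R) :
  \sum_(I : {set T} | I \subset A) y ^+ #|A :\: I| = (1 + y) ^+ #|A| /\
  \sum_(I : {set T} | I \subset A) y ^+ #|A :\: I| * #|I|.+1%:R =
    (1 + y) ^+ #|A| + #|A|%:R * (1 + y) ^+ #|A|.-1.
Proof.
elim: {A}_.+1 {-2}A (ltnSn #|A|) => // m IH A; rewrite ltnS => Am.
have [A0|[a aA]] := finset.set_0Vmem A.
  rewrite A0 !(big_pred1 finset.set0); try by move=> I; rewrite /= finset.subset0.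
  by rewrite finset.setD0 finset.cards0 !expr0 mul0r addr0 mul1r.
have cA : #|A| = #|A :\ a|.+1 by rewrite (finset.cardsD1 a) aA.
have [IH1 IH2] := IH (A :\ a) ltac:(lia).
have cI (I : {set T}) : I \subset A :\ a ->
    [/\ #|A :\: I| = #|A :\ a :\: I|.+1, #|A :\: (a |: I)| = #|A :\ a :\: I|
      & #|a |: I| = #|I|.+1].
  rewrite finset.subsetD1 => /andP[IA aI]; split.
  - rewrite (finset.cardsD1 a) !inE aI aA; congr (_.+1).
    by apply: eq_card => x; rewrite !inE; do ![case: (_ \in _)|case: (_ == _)].
  - by apply: eq_card => x; rewrite !inE; do ![case: (_ \in _)|case: (_ == _)].
  - by rewrite finset.cardsU1 aI.
rewrite !(big_subset_setD1 _ _ aA) cA exprS; split.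
  rewrite -IH1 mulr_sumr; apply: eq_bigr => I /cI[-> -> _].
  by rewrite exprS mulrDl mul1r addrC.
rewrite (eq_bigr (fun I : {set T} =>
  (1 + y) * (y ^+ #|A :\ a :\: I| * #|I|.+1%:R) + y ^+ #|A :\ a :\: I|)); last first.
  move=> I /cI[-> -> ->]; rewrite exprS -[#|I|.+2%:R]natr1 /=.
  move: (y ^+ _) #|I|.+1%:R => p q; ring.
rewrite big_split /= -mulr_sumr IH1 IH2 -natr1.
by case: #|A :\ a| => [|c]; rewrite /= ?exprS ?expr0; ring.
Qed.

(** * Sign cones met by a half-plane in general position *)

Section LinearAlgebra.
Variables (R : realType) (d : nat).
Local Notation V := 'rV[R]_d.
Implicit Types (x y z u : V) (W : 'M[R]_d) (A B I S : {set 'I_d}).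

Lemma dotE x y : dot x y = (x *m y^T) 0 0.
Proof. by rewrite mxE; apply: eq_bigr => i _; rewrite mxE. Qed.

Lemma dotC x y : dot x y = dot y x.
Proof. by apply: eq_bigr => i _; rewrite mulrC. Qed.

Lemma dotDl x y z : dot (x + y) z = dot x z + dot y z.
Proof. by rewrite !dotE mulmxDl mxE. Qed.

Lemma dotZl (c : R) x y : dot (c *: x) y = c * dot x y.
Proof. by rewrite !dotE -scalemxAl mxE. Qed.

Lemma dotNl x y : dot (- x) y = - dot x y.
Proof. by rewrite -scaleN1r dotZl mulN1r. Qed.

Lemma dotBr x y z : dot x (y - z) = dot x y - dot x z.
Proof. by rewrite !(dotC x) dotDl dotNl. Qed.

Lemma dotxx_ge0 x : 0 <= dot x x.
Proof. by apply: sumr_ge0 => i _; rewrite -expr2 sqr_ge0. Qed.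

Lemma dotxx_eq0 x : (dot x x == 0) = (x == 0).
Proof.
apply/eqP/eqP => [h|->]; last by rewrite dotE mul0mx mxE.
apply/rowP => j; rewrite mxE; apply/eqP.
have /psumr_eq0P := h; move/(_ (fun i _ => sqr_ge0 (x 0 i))) => /(_ j isT).
by move/eqP; rewrite mulf_eq0 orbb.
Qed.

Lemma dot_mulmx x (M : 'M[R]_d) y : dot (x *m M) y = dot x (y *m M^T).
Proof. by rewrite !dotE trmx_mul trmxK mulmxA. Qed.

(* The reflection in the hyperplane orthogonal to [a - b]. *)
Lemma exists_reflection (a b : V) : dot a a = dot b b ->
  exists Q : 'M[R]_d, [/\ orthogonal_mx Q, a *m Q = b
    & forall x, dot x a = dot x b -> x *m Q = x].
Proof.
move=> ab; have [->|nab] := eqVneq a b.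
  exists 1%:M; split; [by rewrite /orthogonal_mx trmx1 mulmx1| |];
  by move=> *; rewrite mulmx1.
set c := a - b; have c0 : dot c c != 0 by rewrite dotxx_eq0 subr_eq0.
pose s := 2 / dot c c; pose Q : 'M[R]_d := 1%:M - s *: (c^T *m c).
have actQ x : x *m Q = x - (s * dot x c) *: c.
  rewrite mulmxBr mulmx1 -scalemxAr mulmxA [x *m c^T]mx11_scalar -dotE.
  by rewrite mul_scalar_mx scalerA.
exists Q; split.
- rewrite /orthogonal_mx; apply/row_matrixP => i; rewrite !rowE mulmxA mulmx1.
  have -> : Q^T = Q.
    by rewrite /Q linearB /= trmx1 linearZ /= trmx_mul trmxK.
  rewrite actQ actQ.
  set e := delta_mx 0 i; rewrite dotDl dotNl dotZl.
  have -> : s * (dot e c - s * dot e c * dot c c) = - (s * dot e c).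
    by rewrite /s; field.
  by rewrite scaleNr opprK subrK.
- rewrite actQ.
  have -> : s * dot a c = 1.
    suff E : dot c c = 2 * dot a c.
      by rewrite /s E mulrAC divff // -E.
    rewrite /c !(dotBr, dotDl, dotNl) (dotC b a) -ab; ring.
  by rewrite scale1r /c opprB addrC subrK.
- by move=> x xab; rewrite actQ /c dotBr xab subrr mulr0 scale0r subr0.
Qed.

(** The row space is the coordinate subspace [E_B] of vectors supported in [B]. *)
Definition coord_proj B : 'M[R]_d := diag_mx (\row_j (j \in B)%:R).

Lemma coord_projE x B j : (x *m coord_proj B) 0 j = x 0 j * (j \in B)%:R.
Proof. by rewrite mul_mx_diag !mxE. Qed.

Lemma sub_coord_proj x B :
  (x <= coord_proj B)%MS <-> forall j, j \notin B -> x 0 j = 0.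
Proof.
split=> [/submxP[y ->] j /negbTE jB|h]; first by rewrite coord_projE jB mulr0.
apply/submxP; exists x; apply/rowP => j; rewrite coord_projE.
by case: (boolP (j \in B)) => [|/h ->]; rewrite ?mulr1 ?mul0r.
Qed.

Lemma rank_coord_proj B : (\rank (coord_proj B) <= #|B|)%N.
Proof.
have -> : coord_proj B = \sum_(i in B) delta_mx i i.
  apply/matrixP => i j; rewrite !mxE summxE; case: eqVneq => [<-|ij] /=.
    rewrite mulr1n; case: (boolP (i \in B)) => iB.
      rewrite (bigD1 i) //= mxE eqxx /= big1 ?addr0 // => l /andP[_ li].
      by rewrite mxE eq_sym (negbTE li).
    rewrite big1 // => l lB; rewrite mxE; case: eqVneq => // il.
    by rewrite il lB in iB.
  rewrite mulr0n big1 // => l lB; rewrite mxE; case: eqVneq => // il.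
  by rewrite /= -il eq_sym (negbTE ij).
rewrite -sum1_card; elim/big_rec2: _ => [|i n M _ h]; first by rewrite mxrank0.
by apply: leq_trans (mxrank_add _ _) _; rewrite leq_add // mxrank_delta.
Qed.

(** A dimension count: projecting [W] to the coordinates outside [B] has rank at most [d - #|B|],
    which is below [\rank W]. Using [row_base W] ensures that a nonzero kernel vector yields a
    nonzero vector of [W]. *)
Lemma exists_in_coord_subspace W B : (d < \rank W + #|B|)%N ->
  exists2 x : V, x != 0 & (x <= W)%MS /\ forall j, j \notin B -> x 0 j = 0.
Proof.
move=> dWB; set M := row_base W *m coord_proj (~: B).
have rM : (\rank M < \rank W)%N.
  have := finset.cardsC B; rewrite card_ord => hB.
  apply: leq_ltn_trans (mxrankM_maxr _ _) _.
  by apply: leq_ltn_trans (rank_coord_proj _) _; lia.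
have : kermx M != 0 by rewrite -mxrank_eq0 mxrank_ker; lia.
case/rowV0Pn => v /sub_kermxP vM v0; exists (v *m row_base W).
  apply: contra v0 => /eqP; rewrite -(mul0mx _ (row_base W)).
  by move/(row_free_inj (row_base_free W)) => ->.
split; first by apply: submx_trans (submxMl _ _) _; rewrite eq_row_base.
move=> j jB; have := congr1 (fun X : V => X 0 j) vM.
by rewrite /M mulmxA coord_projE inE jB mulr1 => ->; rewrite mxE.
Qed.

(** For [S \subset I \subset A] this is the tangent cone at a point of the cube with tight
    coordinates [I], those in [S] being at their lower bound; the coordinates in [A :\: I] are
    free. *)
Definition sign_cone A I S : set V := [set y | [/\ forall j, j \notin A -> y 0 j = 0,
  forall j, j \in S -> 0 <= y 0 j & forall j, j \in I :\: S -> y 0 j <= 0]].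

Definition meets (C D : set V) : Prop := exists2 x, x != 0 & C x /\ D x.

(** When [W] meets [E_A] in a plane, the first clause makes the lines [x_i = 0] of that plane
    pairwise distinct, and the second keeps each of them off the boundary line of the half-plane. *)
Definition generic_position A W u : Prop :=
  (forall i j x, i \in A -> j \in A -> i != j -> (x <= W)%MS ->
     (forall l, l \notin A :\ i :\ j -> x 0 l = 0) -> x = 0) /\
  (forall i x, i \in A -> (x <= W)%MS ->
     (forall l, l \notin A :\ i -> x 0 l = 0) -> dot x u = 0 -> x = 0).

Section Count.
Variables (A : {set 'I_d}) (W : 'M[R]_d) (u : V).
Hypothesis rankW : (d.+1 < \rank W + #|A|)%N.
Hypothesis generic : generic_position A W u.

Local Notation hit I S := `[< meets (sign_cone A I S) (half_subspace W u) >].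

Lemma supp_setD1 i x : (forall l, l \notin A -> x 0 l = 0) -> x 0 i = 0 ->
  forall l, l \notin A :\ i -> x 0 l = 0.
Proof. by move=> xA xi l; rewrite !inE negb_and negbK => /orP[/eqP->|/xA]. Qed.

(** The line [x_i = 0] crosses the boundary transversally, so one of its two rays points into the
    half-plane; [z] spans it. A vector of the line minus the stated multiple of [z] is orthogonal to
    [u], hence zero by the second clause of general position. *)
Lemma exists_boundary_ray i : i \in A -> exists z,
  [/\ forall l, l \notin A -> z 0 l = 0, z 0 i = 0, (z <= W)%MS, 0 < dot z u
    & forall x, (forall l, l \notin A -> x 0 l = 0) -> x 0 i = 0 -> (x <= W)%MS ->
        x = (dot x u / dot z u) *: z].
Proof.
move=> iA; have [z0 z00 [z0W z0A]] : exists2 z : V, z != 0 &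
    (z <= W)%MS /\ forall l, l \notin A :\ i -> z 0 l = 0.
  by apply: exists_in_coord_subspace; have := finset.cardsD1 i A; rewrite iA; lia.
have z0u : dot z0 u != 0.
  by apply: contra z00 => /eqP h; apply/eqP/(generic.2 i) => //.
pose z := Num.sg (dot z0 u) *: z0.
have zA l : l \notin A :\ i -> z 0 l = 0 by move=> h; rewrite mxE z0A ?mulr0.
have zu : 0 < dot z u by rewrite dotZl -normrEsg normr_gt0.
exists z; split=> //.
- by move=> l lA; apply: zA; rewrite !inE (negbTE lA) andbF.
- by apply: zA; rewrite !inE eqxx.
- exact: scalemx_sub.
move=> x xA xi xW; apply/eqP; rewrite -subr_eq0; apply/eqP/(generic.2 i) => //.
- by rewrite addmx_sub ?eqmx_opp // !scalemx_sub.
- by move=> l lA; rewrite !mxE -/(z 0 l) (supp_setD1 xA xi) // z0A // !mulr0 subr0.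
- by rewrite dotDl dotNl dotZl divfK ?subrr // gt_eqF.
Qed.

Lemma sign_cone_setU1 i I S y : i \notin I -> S \subset I ->
  sign_cone A (i |: I) S y <-> sign_cone A I S y /\ y 0 i <= 0.
Proof.
move=> iI SI; have iS : i \notin S by apply: contra iI => /(fintype.subsetP SI).
split=> [[yA yS yI]|[[yA yS yI] yi]].
  split; last by apply: yI; rewrite !inE iS eqxx.
  by split=> // j; rewrite inE => /andP[jS jI]; apply: yI; rewrite !inE jS jI orbT.
split=> // j; rewrite !inE => /andP[jS /orP[/eqP->//|jI]].
by apply: yI; rewrite inE jS.
Qed.

Lemma sign_cone_setU1U1 i I S y : i \notin I -> S \subset I ->
  sign_cone A (i |: I) (i |: S) y <-> sign_cone A I S y /\ 0 <= y 0 i.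
Proof.
move=> iI SI; split=> [[yA yS yI]|[[yA yS yI] yi]].
  split; last by apply: yS; rewrite !inE eqxx.
  split=> // j; first by move=> jS; apply: yS; rewrite !inE jS orbT.
  rewrite inE => /andP[jS jI]; apply: yI; rewrite !inE negb_or jS jI orbT !andbT.
  by apply: contra iI => /eqP<-.
split=> // j; first by rewrite !inE => /orP[/eqP->//|/yS].
rewrite !inE negb_or => /andP[/andP[ji jS]]; rewrite (negbTE ji) /= => jI.
by apply: yI; rewrite inE jS.
Qed.

Lemma sign_cone_comb I S (a b : R) x y : 0 <= a -> 0 <= b ->
  sign_cone A I S x -> sign_cone A I S y -> sign_cone A I S (a *: x + b *: y).
Proof.
move=> a0 b0 [xA xS xI] [yA yS yI]; split=> j h; rewrite !mxE.
- by rewrite xA // yA // !mulr0 addr0.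
- by rewrite addr_ge0 ?mulr_ge0 ?xS ?yS.
- by rewrite -oppr_ge0 opprD -!mulrN addr_ge0 // mulr_ge0 // oppr_ge0 ?xI ?yI.
Qed.

(* [S0] is the sign pattern of the ray where the half-subspace crosses the
   hyperplane [y_i = 0]; a cell is cut in two by that hyperplane exactly when it
   contains this ray. *)
Lemma hit_split i I : i \in A -> I \subset A -> i \notin I ->
  exists S0 : {set 'I_d}, forall S : {set 'I_d}, S \subset I ->
    (hit (i |: I) S + hit (i |: I) (i |: S) = hit I S + (S == S0 :&: I))%N.
Proof.
move=> iA IA iI; have [z [zA zi zW zu zmul]] := exists_boundary_ray iA.
have z0 : z != 0 by apply: contraTneq zu => ->; rewrite dotE mul0mx mxE ltxx.
exists [set j | 0 <= z 0 j]%SET => S SI.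
have low : hit (i |: I) S -> hit I S.
  move=> /asboolP[x x0 [/sign_cone_setU1[]// xS _ xM]]; apply/asboolP; by exists x.
have high : hit (i |: I) (i |: S) -> hit I S.
  move=> /asboolP[x x0 [/sign_cone_setU1U1[]// xS _ xM]]; apply/asboolP; by exists x.
have [SE|nS] := eqVneq S _.
  have zS : sign_cone A I S z.
    split=> // j; first by rewrite SE !inE => /andP[].
    rewrite SE !inE negb_and => /andP[/orP[h _|/negbTE->//]].
    by rewrite ltW // ltNge.
  have zM : half_subspace W u z by split=> //; exact: ltW.
  have -> : hit I S by apply/asboolP; exists z.
  have -> : hit (i |: I) S.
    by apply/asboolP; exists z => //; split=> //; apply/sign_cone_setU1; rewrite ?zi.
  have -> // : hit (i |: I) (i |: S).
  by apply/asboolP; exists z => //; split=> //; apply/sign_cone_setU1U1; rewrite ?zi.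
(* The signs of [z] on [I] are unambiguous: a coordinate [z_j = 0] with [j] in [I], together with
   [z_i = 0], would contradict the first clause of general position. So only the cell of [S0 :&: I]
   contains the ray. *)
have notz c : 0 < c -> ~ sign_cone A I S (c *: z).
  move=> c0 [_ zS zI]; case/eqP: nS; apply/finset.setP => j; rewrite !inE.
  case: (boolP (j \in I)) => jI; last first.
    by rewrite andbF; apply/negbTE; apply: contra jI => /(fintype.subsetP SI).
  rewrite andbT; apply/idP/idP => [/zS|zj]; first by rewrite mxE pmulr_rge0.
  apply: contraT => jS; have := zI j; rewrite inE jS jI mxE pmulr_rle0 // => /(_ isT).
  move=> zj'; have zj0 : z 0 j = 0 by apply/eqP; rewrite eq_le zj zj'.
  case/eqP: z0; apply: (generic.1 i j) => //; first exact: (fintype.subsetP IA).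
    by apply: contraNneq iI => ->.
  by move=> l; rewrite finset.in_setD1 negb_and negbK => /orP[/eqP->//|/(supp_setD1 zA zi)].
have notray x : x != 0 -> sign_cone A I S x -> half_subspace W u x -> x 0 i != 0.
  move=> x0 xS [xW xu]; apply/eqP => xi; have xA : forall l, l \notin A -> x 0 l = 0.
    by case: xS.
  have xE := zmul x xA xi xW; rewrite xE in xS; apply: notz xS.
  rewrite divr_gt0 // lt_neqAle xu andbT eq_sym; apply: contraNneq x0 => xu0.
  by rewrite xE xu0 mul0r scale0r.
have excl : ~~ (hit (i |: I) S && hit (i |: I) (i |: S)).
  apply/negP => /andP[/asboolP[y y0 [/sign_cone_setU1[]// yS yi yM]]].
  move=> /asboolP[x x0 [/sign_cone_setU1U1[]// xS xi xM]].
  have xi0 : 0 < x 0 i by rewrite lt_neqAle xi andbT eq_sym notray.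
  have yi0 : y 0 i < 0 by rewrite lt_neqAle yi andbT notray.
  (* Up to scaling, the point where the segment from [y] to [x] crosses [y_i = 0]. If nonzero, it
     would be a hit on the ray, which this cell does not contain; so [x] and [y] are opposite. *)
  pose w := (- y 0 i) *: x + x 0 i *: y.
  have wS : sign_cone A I S w by apply: sign_cone_comb => //; rewrite oppr_ge0.
  have [w0|w0] := eqVneq w 0; last first.
    have : w 0 i != 0.
      apply: notray => //; case: xM yM => xW xu [yW yu]; split.
        by rewrite addmx_sub // scalemx_sub.
      by rewrite dotDl !dotZl addr_ge0 // mulr_ge0 // oppr_ge0.
    by rewrite !mxE mulrC mulrN addNr eqxx.
  have [I0|[j jI]] := finset.set_0Vmem I.
    move: nS; rewrite I0 finset.setI0; case/negP; apply/eqP.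
    by move: SI; rewrite I0 finset.subset0 => /eqP.
  have wE l : x 0 i * y 0 l = y 0 i * x 0 l.
    have := congr1 (fun X : V => X 0 l) w0; rewrite !mxE mulNr addrC => /eqP.
    by rewrite subr_eq0 => /eqP.
  (* Opposite vectors in the same sign cone vanish on all of [I]. Both also lie in the
     half-subspace, so they are orthogonal to [u], against the second clause of general position. *)
  have xj : x 0 j = 0.
    case: xS yS => _ xS xI [_ yS yI]; have := wE j.
    case: (boolP (j \in S)) => jS.
      have := xS j jS; have := yS j jS; move: xi0 yi0; nra.
    have jIS : j \in I :\: S by rewrite inE jS.
    have := xI j jIS; have := yI j jIS; move: xi0 yi0; nra.
  have xu : dot x u = 0.
    have : dot w u = 0 by rewrite w0 dotE mul0mx mxE.
    rewrite dotDl !dotZl; case: xM yM => _ xu [_ yu].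
    move: xi0 yi0 xu yu; nra.
  case/eqP: x0; apply: (generic.2 j x) => //; first exact: (fintype.subsetP IA).
    by case: xM.
  by apply: supp_setD1 xj; case: xS.
have cover : hit I S -> hit (i |: I) S || hit (i |: I) (i |: S).
  move=> /asboolP[x x0 [xS xM]]; apply/orP; have [xi|/ltW xi] := leP (x 0 i) 0.
    by left; apply/asboolP; exists x => //; split=> //; apply/sign_cone_setU1.
  by right; apply/asboolP; exists x => //; split=> //; apply/sign_cone_setU1U1.
move: low high excl cover; rewrite addn0.
case: (hit (i |: I) S); case: (hit (i |: I) (i |: S)); case: (hit I S) => //= a b c e;
  by [case: c | have := a isT | have := b isT | have := e isT].
Qed.

(** Each new line adds one sector: when [hit_split] is summed over [S], the correction equals 1 only
    at [S = S0 :&: I]. With no line at all, the single cone is [E_A] itself, and any boundary ray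
    hits it. *)
Lemma card_hit_sign_cones I : I \subset A ->
  (\sum_(S : {set 'I_d} | S \subset I) hit I S)%N = #|I|.+1.
Proof.
elim: {I}_.+1 {-2}I (ltnSn #|I|) => // n IH I; rewrite ltnS => In IA.
have [I0|[i iI]] := finset.set_0Vmem I.
  rewrite I0 finset.cards0 (big_pred1 finset.set0); last by move=> S; rewrite /= finset.subset0.
  have [i iA] : exists i, i \in A.
    by apply/card_gt0P; move: rankW; have := rank_leq_row W; lia.
  have [z [zA zi zW zu _]] := exists_boundary_ray iA.
  have -> // : hit finset.set0 finset.set0; apply/asboolP; exists z; last first.
    by split; [split=> // j; rewrite !inE|split=> //; exact: ltW].
  by apply: contraTneq zu => ->; rewrite dotE mul0mx mxE ltxx.
have iA := fintype.subsetP IA i iI; have IiA : I :\ i \subset A.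
  by apply: fintype.subset_trans IA; apply: finset.subD1set.
have iIi : i \notin I :\ i by rewrite !inE eqxx.
have [S0 HS0] := hit_split iA IiA iIi; rewrite finset.setD1K // in HS0.
have cI : #|I| = #|I :\ i|.+1 by rewrite (finset.cardsD1 i) iI.
rewrite (big_subset_setD1 _ _ iI) /= (eq_bigr _ HS0) big_split /= IH //; last by lia.
rewrite (bigD1 (S0 :&: (I :\ i))) ?finset.subsetIr //= eqxx big1 ?addn0 ?addn1; first by rewrite cI.
by move=> S /andP[_ /negbTE->].
Qed.

End Count.
End LinearAlgebra.

(** * Measurability of hitting events *)

Section Measurability.
Variable R : realType.

Lemma exists_ratr_near d (x : 'rV[R]_d) (e : R) : 0 < e ->
  exists q : 'rV[rat]_d, `|x - map_mx ratr q| < e.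
Proof.
move=> e0; have /choice[q hq] : forall j, exists q : rat, `|x 0 j - ratr q| < e.
  move=> j; have /rat_in_itvoo[q] : x 0 j - e < x 0 j + e by lra.
  by rewrite in_itv /= => /andP[h1 h2]; exists q; rewrite ltr_norml; lra.
exists (\row_j q j); rewrite [ltLHS]/Num.norm /= mx_normrE.
by apply/bigmax_ltP; split => // -[i j] _; rewrite !mxE ord1.
Qed.

Lemma exists_countable_dense d (K : set 'rV[R]_d) : K !=set0 ->
  exists D : 'rV[rat]_d * nat -> 'rV[R]_d, (forall i, K (D i)) /\
    forall x e, K x -> 0 < e -> exists i, `|x - D i| < e.
Proof.
move=> [x0 Kx0].
(* The set [K] may contain no rational point, so a point of [K] is chosen in each rational ball that
   meets it, with [x0] as default for the other balls. *)
pose near i := [set x | K x /\ `|x - map_mx ratr i.1| < (i.2 : nat).+1%:R^-1].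
exists (fun i => xget x0 (near i)); split.
  by move=> i; case: xgetP => [x _ [] //|].
move=> x e Kx e0; have [n hn] : exists n : nat, 2 / n.+1%:R < e.
  exists (Num.truncn (2 / e)); rewrite ltr_pdivrMr // mulrC -ltr_pdivrMr //.
  exact: truncnS_gt.
have n0 : 0 < n.+1%:R^-1 :> R by [].
have [q hq] := exists_ratr_near x n0.
exists (q, n); case: xgetP => [y _ [_ /= hy]|/(_ x)[]]; last by [].
rewrite (_ : x - y = (x - map_mx ratr q) - (y - map_mx ratr q)); last first.
  by rewrite opprB addrA subrK.
apply: le_lt_trans (ler_normB _ _) _; apply: lt_trans hn.
by rewrite mulrDl mul1r ltrD.
Qed.

(** An uncountable union becomes countable: a continuous function on a compact set attains its
    minimum, so it has a value [<= 0] as soon as its values at a dense sequence get below every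
    [1 / (m + 1)]. *)
Lemma measurable_exists_compact d (dT : measure_display) (T : measurableType dT)
    (K : set 'rV[R]_d) (g : 'rV[R]_d -> T -> R) :
  compact K -> (forall w, continuous (g^~ w)) ->
  (forall x e, measurable [set w | g x w < e]) ->
  measurable [set w | exists2 x, K x & g x w <= 0].
Proof.
move=> cK cg mg; have [K0|K0] := pselect (K !=set0); last first.
  rewrite (_ : mkset _ = set0) //; apply/seteqP; split => // w [x Kx _].
  by apply: K0; exists x.
have [D [DK Dd]] := exists_countable_dense K0.
rewrite (_ : mkset _ = \bigcap_(m : nat) \bigcup_i [set w | g (D i) w < m.+1%:R^-1]).
  apply: bigcapT_measurable => m; apply: countable_bigcupT_measurable => //.
apply/seteqP; split => [w [x Kx gx] m _|w h].
  have : nbhs x (g^~ w @^-1` [set t | t < m.+1%:R^-1]).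
    apply: cg; apply: open_nbhs_nbhs; split; first exact: open_lt.
    by apply: le_lt_trans gx _.
  move=> /nbhs_ballP[e e0 be]; have [i hi] := Dd x e Kx e0.
  by exists i => //; apply: be; rewrite -ball_normE.
have [c cK' cmin] := EVT_min_rV K0 cK (continuous_subspaceT (cg w)).
exists c; first exact: set_mem.
rewrite leNgt; apply/negP => gc0.
have [i _ /=] := h (Num.truncn (g c w)^-1) I.
apply/negP; rewrite -leNgt; apply: le_trans (cmin (D i) _); last exact/mem_set/DK.
by rewrite -[leRHS]invrK lef_pV2 ?posrE ?invr_gt0 // ltW // truncnS_gt.
Qed.

Lemma preimage_open_measurable (dT : measure_display) (T : measurableType dT)
    (S : ptopologicalType) (X : T -> S) (O : set S) :
  borel_measurable X -> open O -> measurable (X @^-1` O).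
Proof.
move=> mX oO; rewrite -[X in measurable X]setTI; apply: mX => //.
exact: sub_sigma_algebra.
Qed.

(** A projection matrix [W] has [x] in its row space exactly when [x *m W = x]. This turns the
    equation into a scalar inequality, continuous in each argument. *)
Definition residual d (x : 'rV[R]_d) (W : 'M[R]_d) : R :=
  \sum_j `|\sum_i x 0 i * W i j - x 0 j|.

Lemma residual_le0 d (x : 'rV[R]_d) W : (residual x W <= 0) = (x *m W == x).
Proof.
apply/idP/eqP => [h|xW]; last first.
  rewrite /residual big1 // => j _; apply/eqP; rewrite normr_eq0 subr_eq0.
  by rewrite -[in eqbRHS]xW mxE.
apply/rowP => j; rewrite mxE; apply/eqP; rewrite -subr_eq0 -normr_le0.
apply: le_trans h.
by rewrite /residual [leRHS](bigD1 j) //= lerDl sumr_ge0.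
Qed.

Lemma continuous_sum_real (T : topologicalType) (I : finType) (F : I -> T -> R) :
  (forall i, continuous (F i)) -> continuous (fun x => \sum_i F i x).
Proof.
move=> cF; apply: continuous_big => //.
by move=> x; apply: cvgD; [exact: cvg_fst|exact: cvg_snd].
Qed.

Lemma continuous_sum_norm (T : topologicalType) (I : finType) (F : I -> T -> R) :
  (forall i, continuous (F i)) -> continuous (fun x => \sum_i `|F i x|).
Proof.
move=> cF; apply: (@continuous_sum_real _ _ (fun i x => `|F i x|)) => i x.
by apply: continuous_comp; [exact: cF|exact: norm_continuous].
Qed.

Lemma continuous_residual d (W : 'M[R]_d) :
  continuous (fun x : 'rV[R]_d => residual x W).
Proof.
apply: continuous_sum_norm => j x.
apply: continuousB; last exact: coord_continuous.
apply: (@continuous_sum_real _ _ (fun i (x : 'rV[R]_d) => x 0 i * W i j)) => i {}x.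
by apply: continuousM; [exact: coord_continuous|exact: cst_continuous].
Qed.

Lemma continuous_residual_mx d (x : 'rV[R]_d) :
  continuous (residual x : 'M[R]_d -> R).
Proof.
apply: continuous_sum_norm => j W; apply: continuousB; last exact: cst_continuous.
apply: (@continuous_sum_real _ _ (fun i (W : 'M[R]_d) => x 0 i * W i j)) => i {}W.
by apply: continuousM; [exact: cst_continuous|exact: coord_continuous].
Qed.

Lemma continuous_dot d (x : 'rV[R]_d) : continuous (dot x).
Proof.
apply: (@continuous_sum_real _ _ (fun i (y : 'rV[R]_d) => x 0 i * y 0 i)) => i y.
by apply: continuousM; [exact: cst_continuous|exact: coord_continuous].
Qed.

Lemma continuous_dotl d (u : 'rV[R]_d) : continuous (fun x => dot x u).
Proof. by under eq_fun do rewrite dotC; exact: continuous_dot. Qed.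

(* [psi] allows to impose [dot x u >= 0], [dot x u = 0], or nothing at all. *)
Lemma measurable_exists_fixed d (dT : measure_display) (T : measurableType dT)
    (W : T -> 'M[R]_d) (U : T -> 'rV[R]_d) (C : set 'rV[R]_d) (psi : R -> R) :
  borel_measurable W -> borel_measurable U -> closed C ->
  (forall c x, 0 < c -> C x -> C (c *: x)) ->
  continuous psi -> (forall c t, 0 < c -> psi (c * t) = c * psi t) ->
  measurable [set w | exists2 x, x != 0 &
    [/\ C x, x *m W w = x & psi (dot x (U w)) <= 0]].
Proof.
move=> mW mU clC coneC cpsi hpsi.
(* All conditions are positively homogeneous, so a nonzero witness can be normalised into a compact
   set. *)
pose K := C `&` [set x | `|x| = 1].
pose g (x : 'rV[R]_d) w := Num.max (residual x (W w)) (psi (dot x (U w))).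
rewrite (_ : mkset _ = [set w | exists2 x, K x & g x w <= 0]).
  apply: measurable_exists_compact.
  - apply: bounded_closed_compact.
      exists 1; split => // M M1 x [_ /= ->]; exact: ltW.
    apply: closedI => //; apply: (@preimage_closed _ _ (fun x : 'rV[R]_d => `|x| : R) [set 1]).
      by move=> x _; exact: norm_continuous.
    exact: closed_eq.
  - move=> w x; apply: (@continuous_max _ _ (fun x => residual x (W w))
                            (fun x => psi (dot x (U w)))).
      exact: continuous_residual.
    by apply: continuous_comp; [exact: continuous_dotl|exact: cpsi].
  - move=> x e.
    rewrite (_ : mkset _ = (W @^-1` (residual x @^-1` [set t | t < e])) `&`
                           (U @^-1` ((psi \o dot x) @^-1` [set t | t < e]))).
      apply: measurableI; apply: preimage_open_measurable => //.
        by apply: open_comp; [move=> *; exact: continuous_residual_mx|exact: open_lt].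
      apply: open_comp; last exact: open_lt.
      move=> u _; apply: continuous_comp; [exact: continuous_dot|exact: cpsi].
    apply/seteqP; split => w; rewrite /g /= gt_max; first by move=> /andP[].
    by move=> [h1 h2]; apply/andP.
apply/seteqP; split=> w [x].
  move=> x0 [Cx xW xU]; have nx : 0 < `|x| by rewrite normr_gt0.
  have nx' : 0 < `|x|^-1 by rewrite invr_gt0.
  exists (`|x|^-1 *: x).
    split; first exact: coneC.
    by rewrite /= normrZ gtr0_norm // mulVf // gt_eqF.
  rewrite /g ge_max residual_le0 -scalemxAl xW eqxx dotZl hpsi //=.
  by rewrite pmulr_rle0.
move=> [Cx nx]; rewrite /g ge_max residual_le0 => /andP[/eqP xW xU].
exists x => //; apply: contraTneq isT => x0; move: nx; rewrite /= x0 normr0.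
by move/eqP; rewrite eq_sym oner_eq0.
Qed.

End Measurability.

(** * Expected counts, null sets by packing, and product laws *)

Section Probability.
Context (R : realType) (dO : measure_display) (Omega : measurableType dO).
Variable P : probability Omega R.

Let count (I : finType) (Q : pred I) (A : I -> set Omega) (w : Omega) : \bar R :=
  (\sum_(i | Q i) `[< A i w >])%N%:R%:E.

Lemma countE (I : finType) (Q : pred I) (A : I -> set Omega) w :
  count Q A w = (\sum_(i <- [seq i <- index_enum I | Q i]) (\1_(A i) w)%:E)%E.
Proof.
by rewrite /count natr_sum sumEFin big_filter; congr EFin.
Qed.

Lemma measurable_count (I : finType) (Q : pred I) (A : I -> set Omega) :
  (forall i, measurable (A i)) -> measurable_fun [set: Omega] (count Q A).
Proof.
move=> mA; rewrite (_ : count Q A = fun w =>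
  (\sum_(i <- [seq i <- index_enum I | Q i]) (\1_(A i) w)%:E)%E); last first.
  by apply/funext => w; exact: countE.
apply: emeasurable_sum => i; apply/measurable_EFinP; exact: measurable_indic.
Qed.

Lemma sum_probability (I : finType) (Q : pred I) (A : I -> set Omega) :
  (forall i, measurable (A i)) ->
  (\sum_(i | Q i) P (A i) = \int[P]_w count Q A w)%E.
Proof.
move=> mA; under eq_integral do rewrite countE.
rewrite ge0_integral_sum //=.
  rewrite big_filter; apply: eq_bigr => i _.
  by rewrite integral_indic ?setIT.
by move=> i; apply/measurable_EFinP; exact: measurable_indic.
Qed.

(** By linearity of expectation [n * p] is the expected number of the first [n] events that occur,
    so it is at most [N] for every [n]. *)
Lemma null_of_bounded_overlap (A : nat -> set Omega) (p : \bar R) (N : nat) :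
  (forall i, measurable (A i)) -> (forall i, P (A i) = p) ->
  (forall n w, (\sum_(i < n) `[< A i w >] <= N)%N) -> p = 0%E.
Proof.
move=> mA Ap overlap; have p0 : (0 <= p)%E by rewrite -(Ap 0%N).
have pfin : p \is a fin_num by rewrite -(Ap 0%N) fin_num_measure.
apply/eqP; rewrite eq_le p0 andbT -(fineK pfin) lee_fin leNgt; apply/negP => fp.
have main n : n%:R * fine p <= N%:R.
  rewrite -lee_fin EFinM fineK //.
  have -> : (n%:R%:E * p = \sum_(i < n) P (A i))%E.
    rewrite (eq_bigr (fun=> (fine p)%:E)) => [|i _]; last by rewrite Ap fineK.
    by rewrite sumEFin sumr_const card_ord -[fine p *+ n]mulr_natl EFinM fineK.
  rewrite (sum_probability predT (fun i : 'I_n => mA i)).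
  have -> : (N%:R%:E = \int[P]_w (cst N%:R%:E) w)%E.
    by rewrite integral_cst //= probability_setT mule1.
  apply: ge0_le_integral => //.
  - by move=> w _; rewrite /count lee_fin.
  - exact: (measurable_count predT (fun i : 'I_n => mA i)).
  - by move=> w _; rewrite /count lee_fin ler_nat; exact: overlap.
have := main (Num.truncn (N%:R / fine p)).+1.
by rewrite leNgt -ltr_pdivrMr // truncnS_gt.
Qed.

Lemma sum_probability_ae_const (I : finType) (Q : pred I) (A : I -> set Omega)
    (N : set Omega) (c : nat) :
  (forall i, measurable (A i)) -> measurable N -> P N = 0%E ->
  (forall w, ~ N w -> (\sum_(i | Q i) `[< A i w >])%N = c) ->
  \sum_(i | Q i) fine (P (A i)) = c%:R.
Proof.
move=> mA mN N0 Ac; apply: EFin_inj; rewrite -sumEFin.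
rewrite (eq_bigr (fun i => P (A i))); last first.
  by move=> i _; rewrite fineK // fin_num_measure.
rewrite sum_probability //.
rewrite (ge0_ae_eq_integral (g := cst c%:R%:E)) //.
- by rewrite integral_cst //= probability_setT mule1.
- exact: measurable_count.
- by move=> w _; rewrite /count lee_fin.
- by move=> w _; rewrite lee_fin.
- exists N; split => // w; apply: contra_notP => Nw _; by rewrite /count Ac.
Qed.

(** Independence identifies the joint law of [X] and [Y] with the product measure; its value on [Z]
    integrates the measures of the sections, which vanish outside a null set. *)
Lemma independent_null (d1 d2 : measure_display) (T1 : measurableType d1)
    (T2 : measurableType d2) (X : {mfun Omega >-> T1}) (Y : {mfun Omega >-> T2})
    (Z : set (T1 * T2)) (N : set T1) :
  (forall A B, measurable A -> measurable B ->
     P ((X @^-1` A) `&` (Y @^-1` B)) = (P (X @^-1` A) * P (Y @^-1` B))%E) ->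
  measurable Z -> measurable N -> P (X @^-1` N) = 0%E ->
  (forall x, ~ N x -> P (Y @^-1` xsection Z x) = 0%E) ->
  P ((fun w => (X w, Y w)) @^-1` Z) = 0%E.
Proof.
move=> XY mZ mN N0 ZN.
have mXY : measurable_fun setT (fun w => (X w, Y w)).
  by apply: measurable_fun_pair.
pose XYm : {mfun Omega >-> (T1 * T2)%type} := HB.pack (fun w => (X w, Y w))
  (isMeasurableFun.Build _ _ _ _ _ mXY).
have := product_measure_unique (m1 := distribution P X) (m2 := distribution P Y)
  (m' := distribution P XYm) XY mZ.
move=> prodE; change (distribution P XYm Z = 0%E); rewrite -prodE.
rewrite /product_measure1 (ge0_ae_eq_integral (g := cst 0%E)) //.
- by rewrite integral0.
- exact: measurable_fun_xsection.
- exists N; split => // x; apply: contra_notP => Nx _.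
  exact: ZN.
Qed.

End Probability.

(** * General position holds almost surely *)

Section Genericity.
Variables (R : realType) (d : nat).
Local Notation V := 'rV[R]_d.
Implicit Types (M : 'M[R]_d) (B : {set 'I_d}).

(** On the curve [(1, t, ..., t^(d-1))] the linear form [c] is a nonzero polynomial of degree below
    [d] in [t], so it has fewer than [d] roots. The parameters start at 1 so that every coordinate
    of the curve points is nonzero. *)
Lemma moment_curve_hyperplane (c : 'I_d -> R) (n : nat) (Q : pred nat) :
  (exists j, c j != 0) ->
  (forall i, Q i -> \sum_j c j * i.+1%:R ^+ j = 0) ->
  (\sum_(i < n) Q i <= d)%N.
Proof.
move=> [j0 cj0] Qc.
pose p : {poly R} := \poly_(j < d) (if insub j is Some i then c i else 0).
have p0 : p != 0.
  apply: contraNneq cj0 => p0; have := coef_poly d (fun j => if insub j is Some i then c i else 0) j0.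
  rewrite -/p p0 coef0 ltn_ord; case: insubP => [i _ /val_inj-> <- //|].
  by rewrite ltn_ord.
have rootp i : Q i -> root p i.+1%:R.
  move=> /Qc h; apply/eqP; rewrite horner_poly -[RHS]h; apply: eq_bigr => j _.
  by congr (_ * _); case: insubP => [i' _ /val_inj->|]; rewrite ?ltn_ord.
pose rs : seq R := [seq i.+1%:R | i <- iota 0 n & Q i].
have us : uniq rs.
  rewrite map_inj_uniq ?filter_uniq ?iota_uniq // => i j /eqP.
  by rewrite eqr_nat eqSS => /eqP.
have rr : all (root p) rs.
  by apply/allP => _ /mapP[i + ->]; rewrite mem_filter => /andP[/rootp].
have := leq_trans (max_poly_roots p0 rr us) (size_poly _ _).
rewrite size_map size_filter -sum1_count big_mkcond /= => /ltnW h.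
by apply: leq_trans h; rewrite -(big_mkord xpredT (fun i => Q i : nat)) /index_iota subn0;
  apply: leq_sum => i _; case: (Q i).
Qed.

Lemma closed_submx M : closed [set x : V | (x <= M)%MS].
Proof.
pose f (x : V) := \sum_j `|\sum_i x 0 i * (cokermx M) i j|.
rewrite (_ : mkset _ = f @^-1` [set 0]).
  apply: preimage_closed; last exact: closed_eq.
  move=> x _; apply: continuous_sum_norm => j {}x.
  apply: (@continuous_sum_real _ _ _ (fun i (x : V) => x 0 i * cokermx M i j)) => i {}x.
  by apply: continuousM; [exact: coord_continuous|exact: cst_continuous].
apply/seteqP; split => x; rewrite /= submxE.
  move=> /eqP xM; rewrite /f big1 // => j _; apply/eqP; rewrite normr_eq0; apply/eqP.
  by have := congr1 (fun X : V => X 0 j) xM; rewrite !mxE.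
move=> /psumr_eq0P fx; apply/eqP/rowP => j; rewrite !mxE; apply/eqP.
by rewrite -normr_eq0 fx.
Qed.

(** For a projection [W], the event that two subspaces meet nontrivially. The fixed-point equation
    extends it to a Borel set of arbitrary matrices, on which conjugation by orthogonal matrices
    acts. *)
Definition meets_fixed M : set 'M[R]_d :=
  [set W | exists2 x : V, x != 0 & (x <= M)%MS /\ x *m W = x].

Lemma measurable_meets_fixed M : <<s @open 'M[R]_d >> (meets_fixed M).
Proof.
have := @measurable_exists_fixed R d _ (g_sigma_algebraType (@open 'M[R]_d)) id
  (cst 0) [set x | (x <= M)%MS] (cst 0).
rewrite (_ : mkset _ = meets_fixed M).
  apply.
  - exact: measurable_id.
  - exact: measurable_cst.
  - exact: closed_submx.
  - by move=> c x _ /= h; exact: scalemx_sub.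
  - exact: cst_continuous.
  - by move=> c t _; rewrite mulr0.
apply/seteqP; split => W [x x0]; first by move=> [xM xW _]; exists x.
by move=> [xM xW]; exists x.
Qed.

Lemma meets_fixed_conj M (Q : 'M[R]_d) W : orthogonal_mx Q ->
  meets_fixed M (Q^T *m W *m Q) <-> meets_fixed (M *m Q^T) W.
Proof.
move=> QQ; have QtQ := mulmx1C QQ; split=> [[x x0 [xM xW]]|[y y0 [/submxP[z yE] yW]]].
  exists (x *m Q^T).
    by apply: contraNneq x0 => xQ; rewrite -[x]mulmx1 -QtQ mulmxA xQ mul0mx.
  split; first exact: submxMr.
  by rewrite -[in RHS]xW !mulmxA -[RHS]mulmxA QQ mulmx1.
exists (z *m M).
  by apply: contraNneq y0 => zM; rewrite yE mulmxA zM mul0mx.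
split; first exact: submxMl.
by move: yW; rewrite yE !mulmxA => yW; rewrite yW -[LHS]mulmxA QtQ mulmx1.
Qed.

Lemma meets_fixed_sub (M M' : 'M[R]_d) : (M <= M')%MS ->
  meets_fixed M `<=` meets_fixed M'.
Proof. by move=> MM W [x x0 [xM xW]]; exists x => //; split=> //; exact: submx_trans MM. Qed.

Context (dO : measure_display) (Omega : measurableType dO).
Variable P : probability Omega R.

(* Rotations fixing [E_B] move the basis vector [e_a] along the moment curve; a
   proper subspace meets that curve in a bounded number of points, so that it
   contains any given rotate of [e_a] with probability zero. *)
Lemma haar_meets_coord_subspace m (W : Omega -> 'M[R]_d) B :
  haar_subspace P m W -> (m + #|B| <= d)%N ->
  P (W @^-1` meets_fixed (coord_proj R B)) = 0%E.
Proof.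
move=> [mW Wgr Winv]; elim: {B}#|B| {-2}B (erefl #|B|) => [|n IH] B cB mB.
  rewrite (_ : _ @^-1` _ = set0) ?measure0 //.
  apply/seteqP; split => // w [x x0 [/sub_coord_proj xB _]].
  have B0 : B = finset.set0 by apply/eqP; rewrite -cards_eq0 cB.
  case/eqP: x0; apply/rowP => j; rewrite mxE xB //.
  by rewrite B0 inE.
have [a aB] : exists a, a \in B by apply/card_gt0P; rewrite cB.
pose B' := (B :\ a)%SET; have cB' : #|B'| = n.
  by have := cardsD1 a B; rewrite aB cB add1n => -[].
have {}IH := IH B' cB' ltac:(lia).
have measW (A : set 'M[R]_d) : <<s @open 'M[R]_d >> A -> measurable (W @^-1` A).
  by move=> mA; rewrite -[_ @^-1` _]setTI; apply: mW.
(* Moment curve points with their [B'] coordinates erased: being orthogonal to [E_B'], they can be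
   reflected to multiples of [e_a] without moving [E_B']. *)
pose v i : V := \row_j (if j \in B' then 0 else i.+1%:R ^+ j).
have aB' : a \notin B' by rewrite !inE eqxx.
have v0 i : 0 < dot (v i) (v i).
  rewrite lt_neqAle eq_sym dotxx_eq0 dotxx_ge0 andbT.
  apply/eqP => /rowP/(_ a); rewrite !mxE (negbTE aB') => /eqP.
  by rewrite expf_eq0 pnatr_eq0 andbF.
pose c i := Num.sqrt (dot (v i) (v i)).
(* Meetings inside [E_B'] are removed: they would belong to all these events at once and destroy the
   bounded overlap. The induction hypothesis handles them separately. *)
pose bad i := meets_fixed (coord_proj R B' + v i)%MS `\` meets_fixed (coord_proj R B').
pose bad0 := meets_fixed (coord_proj R B) `\` meets_fixed (coord_proj R B').
have mbad M M' : <<s @open 'M[R]_d >> (meets_fixed M `\` meets_fixed M').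
  apply: (@measurableD _ (g_sigma_algebraType (@open 'M[R]_d)));
  exact: measurable_meets_fixed.
have Pbad i : P (W @^-1` bad i) = P (W @^-1` bad0).
  pose e : V := c i *: delta_mx 0 a.
  have c0 : c i != 0 by rewrite sqrtr_eq0 -ltNge.
  have ee : dot e e = dot (v i) (v i).
    rewrite dotZl dotC dotZl mulrA -expr2 sqr_sqrtr ?dotxx_ge0 //.
    rewrite [dot (delta_mx 0 a) _](bigD1 a) //= big1 ?addr0.
      by rewrite !mxE !eqxx !mulr1.
    by move=> j ja; rewrite !mxE (negbTE ja) andbF mulr0.
  have [Q [QQ eQ Qfix]] := exists_reflection ee.
  have QtQ := mulmx1C QQ.
  have fixB' : coord_proj R B' *m Q^T = coord_proj R B'.
    rewrite -[in LHS](_ : coord_proj R B' *m Q = coord_proj R B').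
      by rewrite -mulmxA QQ mulmx1.
    apply/row_matrixP => j; rewrite row_mul Qfix //.
    have : (row j (coord_proj R B') <= coord_proj R B')%MS by exact: row_sub.
    move=> /sub_coord_proj; set x := row j _ => xB'.
    rewrite dotC /e dotZl [dot (delta_mx 0 a) x](bigD1 a) //= xB' // mulr0 add0r.
    rewrite big1 ?mulr0; last first.
      by move=> l la; rewrite !mxE (negbTE la) andbF mul0r.
    rewrite [RHS]big1 // => l _; rewrite [v i 0 l]mxE; case: ifPn => [|/xB' ->].
      by rewrite mulr0.
    by rewrite mul0r.
  have veQ : v i *m Q^T = e by rewrite -eQ -mulmxA QQ mulmx1.
  have eqB : (((coord_proj R B' + v i)%MS *m Q^T)%R :=: coord_proj R B)%MS.
    apply: eqmx_trans (addsmxMr _ _ _) _; rewrite fixB' veQ.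
    apply/eqmxP/andP; split.
      rewrite addsmx_sub; apply/andP; split.
        apply/row_subP => j; apply/sub_coord_proj => l lB.
        have /sub_coord_proj : (row j (coord_proj R B') <= coord_proj R B')%MS.
          exact: row_sub.
        by apply; apply: contra lB; rewrite !inE => /andP[].
      apply/sub_coord_proj => l lB; rewrite !mxE; case: (eqVneq l a) => [la|_].
        by rewrite la aB in lB.
      by rewrite andbF mulr0.
    apply/row_subP => j; rewrite /coord_proj row_diag_mx mxE.
    case: (boolP (j \in B)) => jB; last by rewrite scale0r sub0mx.
    rewrite scale1r; have [->|ja] := eqVneq j a.
      rewrite (_ : delta_mx 0 a = (c i)^-1 *: e); last by rewrite scalerA mulVf ?scale1r.
      by rewrite scalemx_sub // addsmxSr.
    apply: submx_trans (addsmxSl _ _); apply/sub_coord_proj => l.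
    rewrite !mxE; case: (eqVneq l j) => [->|]; last by rewrite andbF.
    by rewrite !inE ja jB.
  rewrite -(Winv Q QQ (bad i) (mbad _ _)); congr (P _).
  apply/seteqP; split => w [h1 h2]; split.
  - move/meets_fixed_conj : h1 => /(_ QQ); apply: meets_fixed_sub; by rewrite eqB.
  - by move=> h; apply: h2; apply/meets_fixed_conj => //; rewrite fixB'.
  - apply/meets_fixed_conj => //; apply: meets_fixed_sub h1; by rewrite eqB.
  - by move=> /meets_fixed_conj -/(_ QQ); rewrite fixB'.
have bad0_null : P (W @^-1` bad0) = 0%E.
  apply: (null_of_bounded_overlap (A := fun i => W @^-1` bad i) (N := d) _ Pbad).
    by move=> i; apply: measW; exact: mbad.
  move=> l w.
  (* Since [m + #|B'| < d], the sum of [W] and [E_B'] is a proper subspace; [z] is normal to a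
     hyperplane containing it. Each bad event puts [v i] into this hyperplane. *)
  have [z z0 [zW zB]] : exists2 z : 'cV[R]_d, z != 0 & W w *m z = 0 /\ coord_proj R B' *m z = 0.
    have : (\rank (W w + coord_proj R B')%MS < d)%N.
      apply: leq_ltn_trans (mxrank_adds_leqif _ _) _.
      have := rank_coord_proj R B'; have [_ _ ->] := Wgr w; lia.
    move=> rk; have : cokermx (W w + coord_proj R B')%MS != 0.
      by rewrite -mxrank_eq0 mxrank_coker; lia.
    rewrite -trmx_eq0 => /rowV0Pn[z /submxP[y zE] z0].
    exists z^T; first by rewrite trmx_eq0.
    have sumz : (W w + coord_proj R B')%MS *m z^T = 0.
      by rewrite zE trmx_mul trmxK mulmxA mulmx_coker mul0mx.
    split.
      by have /submxP[D ->] := addsmxSl (W w) (coord_proj R B'); rewrite -mulmxA sumz mulmx0.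
    by have /submxP[D ->] := addsmxSr (W w) (coord_proj R B'); rewrite -mulmxA sumz mulmx0.
  have zB0 j : j \in B' -> z j 0 = 0.
    move=> jB; have := congr1 (fun X : 'cV[R]_d => X j 0) zB.
    by rewrite mul_diag_mx !mxE jB mul1r.
  apply: (@moment_curve_hyperplane (fun j => z j 0) l
    (fun i => `[< (W @^-1` bad i) w >])).
    apply: contrapT => h; case/eqP: z0; apply/colP => j; rewrite mxE.
    by apply: contrapT => hj; apply: h; exists j; exact/eqP.
  move=> i /asboolP[[x x0 [/sub_addsmxP[[y t] /= xE] xW]] notB'].
  have xz : x *m z = 0 by rewrite -xW -mulmxA zW mulmx0.
  have vz : t *m (v i *m z) = 0.
    by move: xz; rewrite xE mulmxDl -!mulmxA zB mulmx0 add0r.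
  (* Without a [v i] component, the fixed vector would lie in [E_B'], which [bad i] excludes. *)
  have t0 : t 0 0 != 0.
    apply/eqP => t0; apply: notB'; exists x => //; split => //.
    by rewrite xE [t]mx11_scalar t0 mul_scalar_mx scale0r addr0 submxMl.
  have {}vz : (v i *m z) 0 0 = 0.
    move: vz; rewrite [t]mx11_scalar mul_scalar_mx => /matrixP/(_ 0 0).
    by rewrite [LHS]mxE [RHS]mxE => /eqP; rewrite mulf_eq0 (negbTE t0) => /eqP.
  rewrite -[RHS]vz mxE; apply: eq_bigr => j _; rewrite mxE mulrC.
  by case: ifPn => // /zB0 ->; rewrite !mulr0.
apply/eqP; rewrite eq_le measure_ge0 andbT.
rewrite (_ : 0 = P (W @^-1` bad0) + P (W @^-1` meets_fixed (coord_proj R B')))%E; last first.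
  by rewrite bad0_null IH adde0.
apply: le_trans (measureU2 _ _ _); last 2 first.
- by apply: measW; exact: mbad.
- by apply: measW; exact: measurable_meets_fixed.
apply: le_measure; rewrite ?inE.
- by apply: measW; exact: measurable_meets_fixed.
- by apply: measurableU; apply: measW; [exact: mbad|exact: measurable_meets_fixed].
- move=> w h; have [h'|h'] := pselect (meets_fixed (coord_proj R B') (W w)).
    by right.
  by left.
Qed.

End Genericity.

Section GenericAE.
Context (R : realType) (d : nat).
Local Notation V := 'rV[R]_d.
Context (dO : measure_display) (Omega : measurableType dO).
Variable P : probability Omega R.
Variables (m : nat) (W : Omega -> 'M[R]_d) (U : Omega -> V).
Hypotheses (hW : haar_subspace P m W) (hU : uniform_on_sphere P U).
Hypothesis hWU : independent P W U.

(** Packing again: by invariance [x] may be turned to the direction of any moment curve point, and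
    the nonzero vector [U w] is orthogonal to fewer than [d] of these points. *)
Lemma uniform_orthogonal_null (x : V) : x != 0 ->
  P (U @^-1` [set u | dot x u = 0]) = 0%E.
Proof.
move=> x0; have [mU Us Uinv] := hU.
have mdot (y : V) : <<s @open V >> [set u | dot y u = 0].
  have cl : closed [set u | dot y u = 0].
    apply: (@preimage_closed _ _ (dot y) [set 0]); last exact: closed_eq.
    by move=> u _; exact: continuous_dot.
  rewrite -[mkset _]setCK.
  apply: (@measurableC _ (g_sigma_algebraType (@open V))).
  by apply: sub_sigma_algebra; exact: closed_openC.
pose v i : V := \row_j i.+1%:R ^+ j.
pose A i := U @^-1` [set u | dot (v i) u = 0].
apply: (null_of_bounded_overlap (A := A) (N := d)).
- by move=> i; rewrite -[A i]setTI; apply: mU => //; exact: mdot.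
- move=> i; have x2 : 0 < dot x x by rewrite lt_neqAle eq_sym dotxx_eq0 x0 dotxx_ge0.
  pose c := Num.sqrt (dot (v i) (v i) / dot x x).
  have cc : dot (c *: x) (c *: x) = dot (v i) (v i).
    rewrite dotZl dotC dotZl mulrA -expr2 sqr_sqrtr ?divr_ge0 ?dotxx_ge0 //.
    by rewrite divfK // gt_eqF.
  have [Q [QQ xQ _]] := exists_reflection cc.
  have QtQt : orthogonal_mx Q^T by rewrite /orthogonal_mx trmxK; exact: mulmx1C.
  rewrite -(Uinv _ QtQt _ (mdot x)); congr (P _).
  (* The vector [x] is nonzero, so some index exists; this rules out [d = 0], where [v i] and hence
     [c] would vanish. *)
  have j : 'I_d.
    case: (pickP (fun j => x 0 j != 0)) => [j _ //|h].
    by case/eqP: x0; apply/rowP => j; rewrite mxE; apply/eqP; have := h j; move/negbFE.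
  have c0 : c != 0.
    rewrite sqrtr_eq0 -ltNge divr_gt0 // lt_neqAle eq_sym dotxx_eq0 dotxx_ge0 andbT.
    by apply/eqP => /rowP/(_ j)/eqP; rewrite !mxE expf_eq0 pnatr_eq0 andbF.
  apply/seteqP; split => w; rewrite /A /= -xQ dot_mulmx dotZl.
    by move/eqP; rewrite mulf_eq0 (negbTE c0) => /eqP.
  by move=> ->; rewrite mulr0.
- move=> n w; apply: (@moment_curve_hyperplane _ _ (fun j => U w 0 j) n
    (fun i => `[< A i w >])) => [|i /asboolP].
    apply: contrapT => h; have := Us w; rewrite /unit_sphere /= => uw.
    have : dot (U w) (U w) = 0.
      apply: big1 => j _; have [->|uj] := eqVneq (U w 0 j) 0; first by rewrite mulr0.
      by case: h; exists j.
    by rewrite uw => /eqP; rewrite oner_eq0.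
  rewrite /A /= => h; rewrite -[RHS]h; apply: eq_bigr => j _.
  by rewrite mxE mulrC.
Qed.

Lemma row_fixed w (x : V) : (x <= W w)%MS -> x *m W w = x.
Proof.
have [_ Wgr _] := hW; have [_ WW _] := Wgr w.
by move=> /submxP[y ->]; rewrite -mulmxA WW.
Qed.

Lemma coord_subspace_ae (B : {set 'I_d}) : (m + #|B| <= d)%N ->
  {ae P, forall w (x : V), (x <= W w)%MS -> (forall l, l \notin B -> x 0 l = 0) -> x = 0}.
Proof.
move=> mB; exists (W @^-1` meets_fixed (coord_proj R B)); split.
- have [mW _ _] := hW; rewrite -[_ @^-1` _]setTI; apply: mW => //.
  exact: measurable_meets_fixed.
- exact: haar_meets_coord_subspace hW mB.
move=> w /= h; apply: contrapT => h'; apply: h => x xW xB.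
apply: contrapT => x0; apply: h'; exists x; first exact/eqP.
by split; [exact/sub_coord_proj|exact: row_fixed].
Qed.

(* Outside of a null set of [W], the intersection with [E_B] is at most a line,
   which the independent uniform vector [u] is orthogonal to with probability 0. *)
Lemma coord_subspace_orthogonal_ae (B : {set 'I_d}) : (0 < #|B|)%N ->
  (m + #|B| <= d.+1)%N ->
  {ae P, forall w (x : V), (x <= W w)%MS -> (forall l, l \notin B -> x 0 l = 0) ->
     dot x (U w) = 0 -> x = 0}.
Proof.
move=> B0 mB; have [mW _ _] := hW; have [mU _ _] := hU.
have [b bB] : exists b, b \in B by exact/card_gt0P.
pose B' := (B :\ b)%SET; have cB : #|B| = #|B'|.+1 by rewrite (cardsD1 b) bB.
pose T1 := g_sigma_algebraType (@open 'M[R]_d); pose T2 := g_sigma_algebraType (@open V).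
pose X : {mfun Omega >-> T1} := HB.pack (W : Omega -> T1)
  (isMeasurableFun.Build _ _ _ _ _ (mW : measurable_fun setT (W : Omega -> T1))).
pose Y : {mfun Omega >-> T2} := HB.pack (U : Omega -> T2)
  (isMeasurableFun.Build _ _ _ _ _ (mU : measurable_fun setT (U : Omega -> T2))).
pose Z : set (T1 * T2) := [set z | exists2 x : V, x != 0 &
    [/\ (x <= coord_proj R B)%MS, x *m (z.1 : 'M[R]_d) = x & `|dot x z.2| <= 0]].
have mZ : measurable Z.
  apply: (measurable_exists_fixed (psi := Num.norm)).
  - exact: measurable_fst.
  - exact: measurable_snd.
  - exact: closed_submx.
  - by move=> c x _ /= h; exact: scalemx_sub.
  - by move=> x; exact: norm_continuous.
  - by move=> c t c0; rewrite normrM gtr0_norm.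
have Znull : P ((fun w => (X w, Y w)) @^-1` Z) = 0%E.
  (* The exceptional set consists of the subspaces that meet [E_B'], one coordinate less than [E_B];
     it is null because [m + #|B'| <= d]. *)
  apply: (@independent_null _ _ _ P _ _ T1 T2 X Y Z (meets_fixed (coord_proj R B'))) => //.
  - exact: measurable_meets_fixed.
  - by apply: haar_meets_coord_subspace hW _; lia.
  - move=> M notM.
    have [[x x0 [xB xM]]|none] := pselect (meets_fixed (coord_proj R B) M); last first.
      rewrite (_ : _ @^-1` _ = set0) ?measure0 //; apply/seteqP; split => // w.
      rewrite /xsection /= inE => -[x x0 [xB xM _]]; apply: none; by exists x.
    rewrite (_ : _ @^-1` _ = U @^-1` [set u | dot x u = 0]).
      exact: uniform_orthogonal_null.
    have xb : x 0 b != 0.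
      apply/eqP => xb; apply: notM; exists x => //; split => //.
      apply/sub_coord_proj => l; rewrite !inE negb_and negbK => /orP[/eqP->//|].
      by move: l; apply/sub_coord_proj.
    apply/seteqP; split => w; rewrite /xsection /= inE; last first.
      by move=> xu; exists x => //; split=> //=; rewrite xu normr0.
    move=> [y y0 [yB /= yM]]; rewrite normr_le0 => /eqP yu.
    (* This combination cancels the coordinate [b], so it lies in [E_B'] and must vanish: [y] is a
       multiple of [x], and one orthogonality condition on [U] covers the whole intersection. *)
    pose z := x 0 b *: y - y 0 b *: x.
    have z0 : z = 0.
      apply: contrapT => z0; apply: notM; exists z; first exact/eqP.
      split; last by rewrite mulmxBl -!scalemxAl xM yM.
      apply/sub_coord_proj => l; rewrite !inE negb_and negbK => /orP[/eqP->|lB].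
        by rewrite !mxE mulrC subrr.
      move/sub_coord_proj: xB => /(_ _ lB) xl; move/sub_coord_proj: yB => /(_ _ lB) yl.
      by rewrite !mxE xl yl !mulr0 subrr.
    have : dot z (U w) = 0 by rewrite z0 dotE mul0mx mxE.
    rewrite dotDl dotNl !dotZl yu mulr0 add0r => /eqP; rewrite oppr_eq0 mulf_eq0.
    move=> /orP[/eqP yb|/eqP //]; case/eqP: y0.
    move: z0; rewrite /z yb scale0r subr0 => /eqP; rewrite scaler_eq0 (negbTE xb).
    by move=> /eqP.
exists ((fun w => (X w, Y w)) @^-1` Z); split => //.
  rewrite -[_ @^-1` _]setTI; apply: (measurable_fun_pair (f := X) (g := Y)) => //.
move=> w /= h; apply: contrapT => h'; apply: h => x xW xB xu.
apply: contrapT => x0; apply: h'; exists x; first exact/eqP.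
split; [exact/sub_coord_proj|exact: row_fixed|by rewrite /= xu normr0].
Qed.

(** Dropping two coordinates of [A] leaves expected intersection dimension at most 0, and dropping
    one leaves at most 1, which orthogonality to [u] lowers once more. Finitely many such conditions
    are combined. *)
Lemma generic_position_ae (A : {set 'I_d}) : (1 < #|A|)%N -> (m + #|A| <= d.+2)%N ->
  {ae P, forall w, generic_position A (W w) (U w)}.
Proof.
move=> A1 mA.
have h1 : {ae P, forall w, forall ij : 'I_d * 'I_d, forall x : V,
    ij.1 \in A -> ij.2 \in A -> ij.1 != ij.2 -> (x <= W w)%MS ->
    (forall l, l \notin A :\ ij.1 :\ ij.2 -> x 0 l = 0) -> x = 0}.
  apply: filter_forall => -[i j] /=.
  have [iA|_] := boolP (i \in A); last exact: filterE.
  have [jA|_] := boolP (j \in A); last exact: filterE.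
  have [->|ij] := eqVneq i j; first by apply: filterE => w x _ _.
  have : (m + #|A :\ i :\ j| <= d)%N.
    have cA : #|A| = #|A :\ i|.+1 by rewrite (cardsD1 i) iA.
    have cAi : #|A :\ i| = #|A :\ i :\ j|.+1.
      by rewrite (cardsD1 j) !inE eq_sym ij jA.
    lia.
  by move=> /coord_subspace_ae; apply: filterS => w h x _ _ _; exact: h.
have h2 : {ae P, forall w, forall i (x : V), i \in A -> (x <= W w)%MS ->
    (forall l, l \notin A :\ i -> x 0 l = 0) -> dot x (U w) = 0 -> x = 0}.
  apply: filter_forall => i.
  have [iA|_] := boolP (i \in A); last exact: filterE.
  have cA : #|A| = #|A :\ i|.+1 by rewrite (cardsD1 i) iA.
  have : (m + #|A :\ i| <= d.+1)%N by lia.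
  move=> /coord_subspace_orthogonal_ae h; have : (0 < #|A :\ i|)%N by lia.
  by move=> /h; apply: filterS => w {}h x _; exact: h.
apply: filterS2 h1 h2 => w h1 h2; split; last exact: h2.
by move=> i j x; exact: (h1 (i, j)).
Qed.

End GenericAE.

(** * The last entry of an h-vector *)

Section HVector.
Variable R : realType.
Implicit Types (a r : nat) (x : R).

Lemma horner_binomial_poly a r x :
  (binomial_poly R a r).[x] = (r`!%:R)^-1 * \prod_(j < r) (x + (a%:R - j%:R)).
Proof.
rewrite hornerZ horner_prod; congr (_ * _).
by apply: eq_bigr => j _; rewrite hornerD hornerX hornerC.
Qed.

Lemma size_binomial_poly a r : (size (binomial_poly R a r) <= r.+1)%N.
Proof.
apply: leq_trans (size_scale_leq _ _) _.
rewrite (eq_bigr (fun j : 'I_r => 'X - (j%:R - a%:R)%:P)).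
  by rewrite size_prod_XsubC /index_enum -enumT size_enum_ord.
by move=> j _; rewrite -opprB polyCN.
Qed.

Lemma binomial_poly_eq0 a r n : (n < a)%N -> (a <= r)%N ->
  (binomial_poly R (r - a) r).[n%:R] = 0.
Proof.
move=> na ar; have jr : (n + (r - a) < r)%N by lia.
rewrite horner_binomial_poly (bigD1 (Ordinal jr)) //= natrD addrA.
by rewrite subrr mul0r mulr0.
Qed.

Lemma binomial_poly_neq0 a r : (a <= r)%N ->
  (binomial_poly R (r - a) r).[a%:R] != 0.
Proof.
move=> ar; rewrite horner_binomial_poly mulf_neq0 ?invr_eq0 ?pnatr_eq0 -?lt0n ?fact_gt0 //.
apply/prodf_neq0 => j _; rewrite addrA -natrD subnKC // subr_eq0 eqr_nat.
by rewrite gtn_eqF.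
Qed.

(** For [a < r] the product contains the factor [t + 1], at index [j = r - a - 1]. Only the last
    basis polynomial survives at [-1], which isolates the last entry of the h-vector. *)
Lemma binomial_poly_at_N1 a r : (a <= r)%N ->
  (binomial_poly R (r - a) r).[-1] = (-1) ^+ r * (a == r)%:R.
Proof.
rewrite leq_eqVlt horner_binomial_poly => /orP[/eqP->|ar].
  rewrite eqxx mulr1 subnn (eq_bigr (fun j : 'I_r => -1 * j.+1%:R)); last first.
    by move=> j _; rewrite mulN1r -addn1 natrD; ring.
  rewrite big_split /= prodr_const card_ord -natr_prod mulrCA.
  have -> : (\prod_(j < r) j.+1)%N = r`!.
    by rewrite fact_prod big_add1 /= big_mkord.
  by rewrite mulVf ?mulr1 // pnatr_eq0 -lt0n fact_gt0.
have jr : ((r - a).-1 < r)%N by lia.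
rewrite (ltn_eqF ar) mulr0 (bigD1 (Ordinal jr)) //=.
suff -> : -1 + ((r - a)%:R - (r - a).-1%:R) = 0 :> R by rewrite mul0r mulr0.
by rewrite -[in (r - a)%:R](@prednK (r - a)) ?subn_gt0 // -addn1 natrD; ring.
Qed.

(* Evaluation of the [binomial_poly (r - i) r] at [0, ..., r] is a triangular
   matrix with nonzero diagonal. *)
Lemma binomial_poly_span r (p : {poly R}) : (size p <= r.+1)%N ->
  exists h : 'I_r.+1 -> R, p = \sum_(i < r.+1) h i *: binomial_poly R (r - i) r.
Proof.
move=> sp.
pose T : 'M[R]_r.+1 := \matrix_(n, i) (binomial_poly R (r - i) r).[n%:R].
have uT : T \in unitmx.
  rewrite unitmxE det_trig; last first.
    apply/is_trig_mxP => n i ni; rewrite mxE binomial_poly_eq0 //.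
    by rewrite -ltnS.
  by rewrite unitfE; apply/prodf_neq0 => i _; rewrite mxE binomial_poly_neq0 // -ltnS.
pose h := invmx T *m \col_n p.[n%:R].
(* By the choice of [h], the difference vanishes at the [r + 1] points [0, ..., r], while its degree
   is at most [r]. *)
exists (fun i => h i 0); apply/eqP; rewrite -subr_eq0; apply/negPn/negP => q0.
set q := p - _ in q0.
have sq : (size q <= r.+1)%N.
  apply: leq_trans (size_polyD _ _) _; rewrite geq_max sp size_polyN.
  apply: leq_trans (size_sum _ _ _) _; apply/bigmax_leqP => i _.
  by apply: leq_trans (size_scale_leq _ _) _; exact: size_binomial_poly.
pose rs : seq R := [seq (n : nat)%:R | n <- iota 0 r.+1].
have urs : uniq rs.
  by rewrite map_inj_uniq ?iota_uniq // => i j /eqP; rewrite eqr_nat => /eqP.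
have rrs : all (root q) rs.
  apply/allP => _ /mapP[n + ->]; rewrite mem_iota add0n leq0n /= => nr.
  rewrite /root /q hornerD hornerN horner_sum subr_eq0; apply/eqP.
  have := mulKVmx uT (\col_n p.[n%:R]) => /matrixP/(_ (Ordinal nr) 0).
  rewrite -/h !mxE /= => <-; apply: eq_bigr => i _.
  by rewrite hornerZ mxE mulrC.
have := leq_trans (max_poly_roots q0 rrs urs) sq.
by rewrite size_map size_iota ltnn.
Qed.

Lemma hvector_last r (h : 'I_r.+1 -> R) :
  (\sum_(i < r.+1) h i *: binomial_poly R (r - i) r).[-1] = (-1) ^+ r * h ord_max.
Proof.
rewrite horner_sum (bigD1 ord_max) //= big1 => [|i ir].
  by rewrite addr0 hornerZ binomial_poly_at_N1 // eqxx mulr1 mulrC.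
have ir' : (i == r :> nat) = false.
  by apply/negbTE; apply: contra ir => /eqP h'; apply/eqP/val_inj.
by rewrite hornerZ (binomial_poly_at_N1 (leq_ord i)) ir' !mulr0.
Qed.

End HVector.

(** * Lattice points and tangent cones of cubes *)

Section Cube.
Variables (R : realType) (d : nat) (A : {set 'I_d}).
Local Notation V := 'rV[R]_d.

Definition cube (n : nat) : set V :=
  [set x : V | forall j, if j \in A then 0 <= x 0 j <= n%:R else x 0 j == 0].

Definition indicator_row (S : {set 'I_d}) : V := \row_j (j \in S :&: A)%:R.

Lemma convex_hull_indicator_rows : cube 1 = convex_hull (range indicator_row).
Proof.
apply/seteqP; split => [x cx|x [n [s [c [sA c0 c1 ->]]]] j]; last first.
  have sj i : s i 0 j = 0 \/ j \in A /\ s i 0 j = 1.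
    have [S _ <-] := sA i; rewrite mxE inE.
    by case: (j \in S); case: (j \in A); [right|left|left|left].
  rewrite summxE; case: ifPn => jA.
    apply/andP; split.
      apply: sumr_ge0 => i _; rewrite mxE mulr_ge0 //.
      by case: (sj i) => [|[_]] ->.
    rewrite -c1; apply: ler_sum => i _; rewrite mxE ler_piMr //.
    by case: (sj i) => [|[_]] ->.
  rewrite big1 ?eqxx // => i _; rewrite mxE; case: (sj i) => [->|[]]; first by rewrite mulr0.
  by rewrite (negbTE jA).
(* The weight of [S] is the probability that independent Bernoulli variables with means [x_j] are
   equal to 1 exactly on [S]; their mean vector is [x]. *)
pose w (S : {set 'I_d}) := \prod_j (if j \in S then x 0 j else 1 - x 0 j).
have x01 j : 0 <= x 0 j <= 1.
  by have := cx j; case: ifP => // _ /eqP->; rewrite lexx ler01.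
exists #|{set 'I_d}|, (fun i => indicator_row (enum_val i)), (fun i => w (enum_val i)).
split.
- by move=> i; exists (enum_val i).
- move=> i; apply: prodr_ge0 => j _; case: ifP => _; have /andP[] := x01 j; lra.
- rewrite -(big_enum_val (fun S => w S)) /= /w -bigA_distr big1 // => j _.
  by rewrite /=; ring.
apply/rowP => l; rewrite summxE.
under eq_bigr do rewrite mxE mxE.
rewrite -(big_enum_val (fun S => w S * (l \in S :&: A)%:R)) /=.
have [lA|lA] := boolP (l \in A); last first.
  rewrite big1 => [|S _]; last by rewrite inE (negbTE lA) andbF mulr0.
  by have := cx l; rewrite (negbTE lA) => /eqP.
(* Replacing [1 - x_l] by 0 before expanding keeps only the sets containing [l], so their total
   weight is [x_l]. *)
transitivity (\prod_j (x 0 j + (if j == l then 0 else 1 - x 0 j))).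
  rewrite (bigD1 l) //= eqxx addr0 big1 ?mulr1 // => j /negbTE->.
  by rewrite addrC subrK.
rewrite bigA_distr; apply: eq_bigr => S _; rewrite inE lA andbT.
have [lS|lS] := boolP (l \in S).
  rewrite mulr1; apply: eq_bigr => j _; case: (boolP (j \in S)) => // jS.
  by case: eqVneq jS => // ->; rewrite lS.
by rewrite mulr0 (bigD1 l) //= (negbTE lS) eqxx mul0r.
Qed.

Lemma lattice_polytope_cube : lattice_polytope (cube 1).
Proof.
exists (range indicator_row); split; last exact: convex_hull_indicator_rows.
  exact/finite_image/finite_finset.
by move=> _ [S _ <-] j; rewrite mxE natr_int.
Qed.

Lemma cube_nonempty : cube 1 !=set0.
Proof. by exists 0 => j; rewrite mxE lexx ler01 eqxx if_same. Qed.

Lemma has_dim_cube : has_dim (cube 1) #|A|.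
Proof.
pose X : #|A|.-tuple V := [tuple delta_mx 0 (enum_val i) | i < #|A|].
have XE (i : 'I_#|A|) : X`_i = delta_mx 0 (enum_val i).
  by rewrite -tnth_nth tnth_mktuple.
have spanX (x : V) : x \in <<X>>%VS <-> forall j, j \notin A -> x 0 j = 0.
  split=> [/coord_span -> j jA|xA].
    rewrite summxE big1 // => i _; rewrite XE !mxE eqxx /=.
    case: eqVneq => [ji|_]; last by rewrite mulr0.
    by rewrite ji enum_valP in jA.
  rewrite [x]row_sum_delta; apply: rpred_sum => j _.
  have [jA|/xA->] := boolP (j \in A); last by rewrite scale0r mem0v.
  apply/rpredZ/memv_span/(nthP 0); exists (enum_rank_in jA j); first by rewrite size_tuple.
  by rewrite XE enum_rankK_in.
have freeX : free X.
  apply/freeP => c c0 i; have /rowP/(_ (enum_val i)) := c0.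
  rewrite summxE (bigD1 i) //= XE !mxE !eqxx mulr1 big1 ?addr0 // => l li.
  rewrite XE !mxE eqxx /=; case: eqVneq => [/enum_val_inj il|]; last by rewrite mulr0.
  by rewrite il eqxx in li.
exists 0, <<X>>%VS; split; last first.
  by move: freeX; rewrite /free size_tuple => /eqP.
apply/seteqP; split => [x [n [s [c [sA _ ->]]]]|_ [x /spanX xA <-]].
  exists (\sum_i c i *: s i); last by rewrite add0r.
  apply/spanX => j jA; rewrite summxE big1 // => i _; rewrite mxE.
  by have := sA i j; rewrite (negbTE jA) => /eqP->; rewrite mulr0.
(* The points are the origin, whose coefficient makes the total 1, and the basis vectors; those
   outside [A] are replaced by 0 to stay in the cube. *)
pose s (i : 'I_d.+1) : V :=
  if unlift ord0 i is Some j then (j \in A)%:R *: delta_mx 0 j else 0.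
pose c (i : 'I_d.+1) : R :=
  if unlift ord0 i is Some j then x 0 j else 1 - \sum_j x 0 j.
exists d.+1, s, c; split.
- move=> i j; rewrite /s; case: unliftP => [l _|_]; last first.
    by rewrite mxE lexx ler01 eqxx if_same.
  rewrite !mxE eqxx /=; have [jA|jA] := boolP (j \in A); last first.
    by case: (eqVneq j l) => [<-|_]; rewrite ?(negbTE jA) ?mul0r ?mulr0.
  by case: (l \in A); case: (j == l); rewrite ?mulr1 ?mulr0 ?lexx ?ler01.
- rewrite big_ord_recl /c unlift_none.
  rewrite [X in _ + X](eq_bigr (fun j => x 0 j)) ?subrK // => j _.
  by rewrite liftK.
- rewrite add0r big_ord_recl /s unlift_none scaler0 add0r [LHS]row_sum_delta.
  apply: eq_bigr => j _; rewrite /c /= liftK scalerA.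
  by have [jA|/xA->] := boolP (j \in A); rewrite ?mulr1 ?mul0r.
Qed.

Lemma dilate_cube n : (0 < n)%N -> dilate n (cube 1) = cube n.
Proof.
move=> n0; have n0' : 0 < n%:R :> R by rewrite ltr0n.
apply/seteqP; split => [_ [x cx <-] j|x cx].
  have := cx j; rewrite mxE; case: ifP => _ => [/andP[x0 x1]|/eqP->]; last by rewrite mulr0.
  by rewrite mulr_ge0 ?ler0n //= ler_piMr ?ler0n.
exists (n%:R^-1 *: x); last by rewrite scalerA divff ?scale1r // gt_eqF.
move=> j; have := cx j; rewrite mxE; case: ifP => _ => [/andP[x0 x1]|/eqP->]; last by rewrite mulr0.
by rewrite mulr_ge0 ?invr_ge0 ?ler0n //= ler_pdivrMl // mulr1.
Qed.

End Cube.

Section LatticePoints.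
Variables (R : realType) (d : nat) (A : {set 'I_d}) (n : nat).
Hypothesis n0 : (0 < n)%N.
Local Notation V := 'rV[R]_d.
Implicit Types f : {ffun 'I_d -> 'I_n.+1}.

Definition row_of_ffun f : V := \row_j (f j : nat)%:R.
Definition supported f := [forall j, (j \in A) || (f j == 0 :> nat)].
Definition low_face f := [set j in A | f j == 0 :> nat]%SET.
Definition tight_face f := [set j in A | (f j == 0 :> nat) || (f j == n :> nat)]%SET.

Lemma row_of_ffun_inj : injective row_of_ffun.
Proof.
move=> f g /rowP fg; apply/ffunP => j; have := fg j; rewrite !mxE => /eqP.
by rewrite eqr_nat => /eqP h; apply/val_inj.
Qed.

Lemma cube_lattice_points :
  cube A n `&` @int_lattice R d =
    [set row_of_ffun f | f in [set f | supported f]].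
Proof.
apply/seteqP; split => [x [cx ix]|_ [f /= sf <-]]; last first.
  split=> j; rewrite mxE ?natr_int //; have /forallP/(_ j) := sf.
  case: (j \in A) => /= [_|/eqP->]; last by [].
  by rewrite ler0n ler_nat -ltnS ltn_ord.
have xn j : 0 <= x 0 j <= n%:R.
  by have := cx j; case: ifP => // _ /eqP->; rewrite lexx ler0n.
have xt j : (Num.truncn (x 0 j))%:R = x 0 j.
  by apply/truncnK; rewrite natrEint ix; have /andP[] := xn j.
have tn j : (Num.truncn (x 0%R j) < n.+1)%N.
  by rewrite ltnS -(ler_nat R) xt; have /andP[] := xn j.
exists [ffun j => inord (Num.truncn (x 0 j))].
  apply/forallP => j; rewrite ffunE inordK //; have := cx j; case: ifP => //= _ /eqP->.
  by rewrite truncn0.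
by apply/rowP => j; rewrite mxE ffunE inordK.
Qed.

(* Slack at a lattice point is at least one in the coordinates that are not tight. *)
Lemma tangent_cone_cube f : supported f ->
  tangent_cone (cube A n) (row_of_ffun f) = sign_cone A (tight_face f) (low_face f).
Proof.
move=> /forallP sf; apply/seteqP; split => [_ [x [l [cx l0 ->]]]|y [yA yS yI]].
  split=> j; rewrite ?mxE.
  - move=> jA; have := cx j; have := sf j; rewrite (negbTE jA) /= => /eqP-> /eqP->.
    by rewrite subrr mulr0.
  - rewrite inE => /andP[jA /eqP->]; have := cx j; rewrite jA => /andP[xj _].
    by rewrite subr0 mulr_ge0.
  - rewrite !inE => /andP[+ /andP[jA]]; rewrite jA /= => /negbTE-> /= /eqP->.
    have := cx j; rewrite jA => /andP[_ xj].
    by rewrite mulr_ge0_le0 // subr_le0.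
(* Large enough that dividing [y] by [l] moves each coordinate by at most 1, hence within the
   slack. *)
pose l := 1 + \sum_j `|y 0 j|.
have l1 j : `|y 0 j| < l.
  by rewrite /l (bigD1 j) //= addrCA ltrDl ltr_wpDr // sumr_ge0.
have l0 : 0 < l by rewrite ltr_pwDl // sumr_ge0.
exists (row_of_ffun f + l^-1 *: y), l; split; [|exact: ltW|]; last first.
  by rewrite addrC addKr scalerA divff ?scale1r // gt_eqF.
move=> j; have yl : `|l^-1 * y 0 j| <= 1.
  by rewrite normrM gtr0_norm ?invr_gt0 // ler_pdivrMl // mulr1 ltW.
move: yl; rewrite ler_norml !mxE; set t := l^-1 * _ => /andP[t1 t2].
have [jA|jA] := boolP (j \in A); last first.
  by have := sf j; rewrite (negbTE jA) /= => /eqP->; rewrite /t yA // mulr0 addr0.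
have fn : (f j <= n)%N by rewrite -ltnS ltn_ord.
rewrite /=.
have [fj0|fj0] := eqVneq (f j : nat) 0%N.
  have yj : 0 <= y 0 j by apply: yS; rewrite inE jA fj0.
  have t0 : 0 <= t by rewrite /t mulr_ge0 // invr_ge0 ltW.
  have n1 : 1 <= n%:R :> R by rewrite ler1n.
  by rewrite fj0 add0r t0 (le_trans t2 n1).
have [fjn|fjn] := eqVneq (f j : nat) n.
  have yj : y 0 j <= 0 by apply: yI; rewrite !inE jA (negbTE fj0) fjn eqxx.
  have t0 : t <= 0 by rewrite /t mulr_ge0_le0 // invr_ge0 ltW.
  have : 1 <= n%:R :> R by rewrite ler1n.
  by rewrite fjn => n1; apply/andP; split; clearbody t; lra.
have f1 : 1 <= (f j : nat)%:R :> R by rewrite ler1n lt0n.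
have f2 : (f j : nat)%:R + 1 <= n%:R :> R by rewrite natr1 ler_nat ltn_neqAle fjn.
by apply/andP; split; clearbody t; lra.
Qed.

Lemma card_interior_ord : (\sum_(a < n.+1) ((a != 0 :> nat) && (a != n :> nat)) = n.-1)%N.
Proof.
case: n n0 => // m _; rewrite big_ord_recl /= add0n big_ord_recr /= eqxx addn0.
rewrite (eq_bigr (fun=> 1%N)) ?sum1_card ?card_ord // => i _.
by rewrite /bump /= add1n eqSS ltn_eqF.
Qed.

(** The coordinates are chosen independently: the value is 0 on [S] and outside [A], [n] on
    [I :\: S], and one of [n - 1] interior values on [A :\: I]. Since [n > 0], the two end values
    differ. *)
Lemma card_points_of_face (I S : {set 'I_d}) : S \subset I -> I \subset A ->
  #|[pred f | supported f && ((tight_face f, low_face f) == (I, S))]| = (n.-1 ^ #|A :\: I|)%N.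
Proof.
move=> SI IA.
pose F j : pred 'I_n.+1 := fun a => if j \in S then a == 0 :> nat
  else if j \in I then a == n :> nat
  else if j \in A then (a != 0 :> nat) && (a != n :> nat) else a == 0 :> nat.
have nn : (n == 0)%N = false by rewrite -leqn0 leqNgt n0.
have famP f : reflect (forall j, F j (f j)) (f \in family F).
  by apply: (iffP forallP) => h j; exact: h.
rewrite (eq_card (B := family F)) => [|f]; last first.
  rewrite [LHS]inE; apply/andP/famP => [[/forallP sf /eqP[fI fS]] j|fF].
    have := sf j; rewrite /F -fI -fS !inE.
    by case: (j \in A) => //=; case: (f j == 0 :> nat) => //=; case: (f j == n :> nat).
  have fFj j := fF j.
  split.
    apply/forallP => j; have := fFj j; rewrite /F.
    case: ifP => [_ ->|_]; first by rewrite orbT.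
    case: ifP => [/(fintype.subsetP IA)->//|_].
    by case: ifP.
  apply/eqP; congr pair; apply/finset.setP => j; have := fFj j; rewrite !inE /F.
    have [jS|jS] := boolP (j \in S).
      by rewrite (fintype.subsetP SI _ jS) (fintype.subsetP IA _ (fintype.subsetP SI _ jS)) => ->.
    have [jI|jI] := boolP (j \in I).
      by rewrite (fintype.subsetP IA _ jI) => ->; rewrite orbT.
    by case: (j \in A) => //= /andP[/negbTE-> /negbTE->].
  have [jS|jS] := boolP (j \in S).
    by rewrite (fintype.subsetP IA _ (fintype.subsetP SI _ jS)) => ->.
  have [jI|jI] := boolP (j \in I).
    by rewrite (fintype.subsetP IA _ jI) => /eqP->; rewrite nn.
  by case: (j \in A) => //= /andP[/negbTE->].
rewrite -sum1_card (eq_bigr (fun f => \prod_(j : 'I_d) 1)%N); last by move=> f _; rewrite big1.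
rewrite -(bigA_distr_big_dep _ (fun _ _ => 1%N)) /=.
rewrite (eq_bigr (fun j => if j \in A :\: I then n.-1 else 1%N)).
  by rewrite -big_mkcond prod_nat_const.
move=> j _; rewrite sum1_card -sum1_card big_mkcond /= /F inE.
have sum_eq (b : 'I_n.+1) : (\sum_(a < n.+1) (if a == b :> nat then 1 else 0) = 1)%N.
  rewrite -big_mkcond /= (eq_bigl (fun a => a == b)) ?big_pred1_eq //.
have [jS|jS] := boolP (j \in S).
  by rewrite (fintype.subsetP SI _ jS) (sum_eq ord0).
have [jI|jI] := boolP (j \in I); first exact: (sum_eq ord_max).
have [jA|jA] := boolP (j \in A); last exact: (sum_eq ord0).
rewrite /= -card_interior_ord; apply: eq_bigr => a _.
by rewrite unfold_in /=; case: (_ && _).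
Qed.

Lemma sum_cube_lattice_points (g : {set 'I_d} -> {set 'I_d} -> R) (G : V -> R) :
  (forall f, supported f -> G (row_of_ffun f) = g (tight_face f) (low_face f)) ->
  \sum_(v \in cube A n `&` @int_lattice R d) G v =
  \sum_(I : {set 'I_d} | I \subset A) (n.-1%:R ^+ #|A :\: I| *
     \sum_(S : {set 'I_d} | S \subset I) g I S).
Proof.
move=> Gg; rewrite cube_lattice_points fsbig_image; last first.
  by move=> f f' _ _; exact: row_of_ffun_inj.
rewrite -(@bigfs _ _ _ _ (index_enum _) supported) ?index_enum_uniq //=; last first.
  by move=> f _; rewrite mem_index_enum.
rewrite (eq_bigr _ Gg).
rewrite (partition_big (fun f => (tight_face f, low_face f))
  (fun IS : {set 'I_d} * {set 'I_d} => (IS.1 \subset A) && (IS.2 \subset IS.1))) /=; last first.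
  move=> f _; apply/andP; split; apply/fintype.subsetP => j; rewrite !inE => /andP[] //.
  by move=> -> /= ->.
under [RHS]eq_bigr do rewrite mulr_sumr.
rewrite [RHS]pair_big_dep /=; apply: eq_bigr => -[I S] /= /andP[IA SI].
rewrite (eq_bigr (fun=> g I S)); last by move=> f /andP[_ /eqP[-> ->]].
by rewrite sumr_const card_points_of_face // -[LHS]mulr_natl natrX.
Qed.

End LatticePoints.

(** * Grassmann angles of cubes and the negative coefficient *)

Section GrassmannValuation.
Context (R : realType) (d k : nat).
Local Notation V := 'rV[R]_d.
Context (dO : measure_display) (Omega : measurableType dO).
Variable P : probability Omega R.
Variables (W : Omega -> 'M[R]_d) (U : Omega -> V).
Hypotheses (hk : (k + 2 <= d)%N) (hW : haar_subspace P (d - k) W).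
Hypotheses (hU : uniform_on_sphere P U) (hWU : independent P W U).
Variable A : {set 'I_d}.
Hypothesis cA : #|A| = k.+2.

Lemma closed_sign_cone (I S : {set 'I_d}) : closed (sign_cone A I S : set V).
Proof.
pose F j : set R := [set t | [/\ j \notin A -> t = 0, j \in S -> 0 <= t
  & j \in I :\: S -> t <= 0]].
have clF j : closed (F j).
  rewrite (_ : F j = (if j \notin A then [set 0] else setT) `&`
    ((if j \in S then [set t | 0 <= t] else setT) `&`
     (if j \in I :\: S then [set t | t <= 0] else setT))).
    apply: closedI; first by case: ifP => _; [exact: closed_eq|exact: closedT].
    by apply: closedI; case: ifP => _; [exact: closed_ge|exact: closedT|exact: closed_le|exact: closedT].
  apply/seteqP; split => t.
    by move=> [h1 h2 h3]; split; [|split]; case: ifP.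
  move=> [h1 [h2 h3]]; split => h; [move: h1|move: h2|move: h3]; by rewrite h.
rewrite (_ : sign_cone A I S = \bigcap_(j : 'I_d) (fun x : V => x 0 j) @^-1` F j).
  apply: closed_bigI => j _; apply: preimage_closed => // x _.
  exact: coord_continuous.
apply/seteqP; split => x; first by move=> [xA xS xI] j _; split => h; [exact: xA|exact: xS|exact: xI].
by move=> h; split=> j; have [] := h j Logic.I.
Qed.

Let angle_event (I S : {set 'I_d}) : set Omega :=
  [set w | meets (sign_cone A I S) (half_subspace (W w) (U w))].

Lemma measurable_angle_event I S : measurable (angle_event I S).
Proof.
have [mW Wgr _] := hW; have [mU _ _] := hU.
rewrite (_ : angle_event I S = [set w | exists2 x, x != 0 &
    [/\ sign_cone A I S x, x *m W w = x & - dot x (U w) <= 0]]).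
  apply: (measurable_exists_fixed (psi := -%R)) => //.
  - exact: closed_sign_cone.
  - move=> c x c0 [xA xS xI]; split=> j h; rewrite mxE.
    + by rewrite xA ?mulr0.
    + by rewrite mulr_ge0 ?(ltW c0) ?xS.
    + by rewrite pmulr_rle0 ?xI.
  - exact: opp_continuous.
  - by move=> c t _; rewrite mulrN.
apply/seteqP; split => w [x x0].
  move=> [xC [xW xU]]; exists x => //; split=> //; last by rewrite oppr_le0.
  exact: (row_fixed hW).
move=> [xC xW xU]; exists x => //; split=> //; split; last by rewrite -oppr_le0.
by rewrite -xW submxMl.
Qed.

(** Both sets contain the origin, so their intersection differs from the origin alone exactly when
    it has a nonzero element. *)
Lemma grassmann_angle_sign_cone I S :
  grassmann_angle P W U (sign_cone A I S) = fine (P (angle_event I S)).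
Proof.
congr (fine (P _)); apply/seteqP; split => w /=.
  move=> h; apply: contrapT => nomeet; apply: h; apply/seteqP; split => [x [xC xM]|_ ->].
    by apply: contrapT => /eqP x0; apply: nomeet; exists x.
  split; first by split=> j _; rewrite mxE.
  by split; [exact: sub0mx|rewrite dotE mul0mx mxE].
move=> [x /eqP x0 xCM] h; apply: x0.
by have : [set 0] x by rewrite -h.
Qed.

(** The size [k + 2] of [A] meets two opposite bounds with equality: general position requires rank
    plus size at most [d + 2], and the sector count requires at least [d + 2]. *)
Lemma sum_grassmann_angle (I : {set 'I_d}) : I \subset A ->
  \sum_(S : {set 'I_d} | S \subset I) grassmann_angle P W U (sign_cone A I S) =
  #|I|.+1%:R.
Proof.
move=> IA; under eq_bigr do rewrite grassmann_angle_sign_cone.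
have [N [mN N0 subN]] : {ae P, forall w, generic_position A (W w) (U w)}.
  by apply: (generic_position_ae hW hU hWU); rewrite cA; lia.
apply: (sum_probability_ae_const _ mN N0) => [S|w Nw].
  exact: measurable_angle_event.
apply: card_hit_sign_cones IA.
  by have [_ Wgr _] := hW; have [_ _ ->] := Wgr w; rewrite cA; lia.
by apply: contrapT => h; apply: Nw; exact: subN.
Qed.

Lemma grassmann_valuation_cube n : (0 < n)%N ->
  grassmann_valuation P W U (cube A n) = n%:R ^+ k.+2 + k.+2%:R * n%:R ^+ k.+1.
Proof.
move=> n0; rewrite /grassmann_valuation.
rewrite (sum_cube_lattice_points n0
  (g := fun I S => grassmann_angle P W U (sign_cone A I S))); last first.
  by move=> f sf; rewrite tangent_cone_cube.
rewrite (eq_bigr (fun I : {set 'I_d} => n.-1%:R ^+ #|A :\: I| * #|I|.+1%:R)); last first.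
  by move=> I IA; rewrite sum_grassmann_angle.
by rewrite (sum_subset_expr A _).2 nat1r prednK // cA.
Qed.

End GrassmannValuation.

Theorem theorem1p6 (R : realType) (d k : nat) (hk : (k + 2 <= d)%N)
    (dO : measure_display) (Omega : measurableType dO)
    (Pr : probability Omega R)
    (W : Omega -> 'M[R]_d) (U : Omega -> 'rV[R]_d)
    (hW : haar_subspace Pr (d - k) W)
    (hU : uniform_on_sphere Pr U)
    (hWU : independent Pr W U) :
  ~ combinatorially_positive (grassmann_valuation Pr W U).
Proof.
move=> pos; have hk' : (k.+2 <= d)%N by lia.
pose A : {set 'I_d} := [set widen_ord hk' i | i in 'I_k.+2]%SET.
have cA : #|A| = k.+2.
  by rewrite card_imset ?card_ord // => i j /(congr1 val) /= h; apply: val_inj.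
pose p : {poly R} := 'X^(k.+2) + k.+2%:R *: 'X^(k.+1).
have sp : (size p <= k.+3)%N.
  apply: leq_trans (size_polyD _ _) _; rewrite geq_max size_polyXn leqnn /=.
  by apply: leq_trans (size_scale_leq _ _) _; rewrite size_polyXn.
(* Positivity speaks of any [h] satisfying [is_hvector], so an actual h-vector has to be produced to
   refute it. *)
have [h ph] := binomial_poly_span sp.
have hvec : is_hvector (grassmann_valuation Pr W U) (cube A 1) h.
  move=> n n0; rewrite -ph dilate_cube // (grassmann_valuation_cube hk hW hU hWU cA n0).
  by rewrite hornerD hornerZ !hornerXn.
have dimA : has_dim (cube A 1 : set 'rV[R]_d) k.+2 by rewrite -cA; exact: has_dim_cube.
have := pos _ _ _ (lattice_polytope_cube R A) (cube_nonempty R A) dimA hvec ord_max.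
apply/negP; rewrite -ltNge.
have : (-1) ^+ k.+2 * h ord_max = 1 * p.[-1] by rewrite mul1r ph hvector_last.
have -> : p.[-1] = (-1) ^+ k.+2 * (1 - k.+2%:R).
  by rewrite hornerD hornerZ !hornerXn [(-1) ^+ k.+2]exprS; ring.
rewrite mul1r => /(mulfI _) ->; last by rewrite signr_eq0.
by rewrite subr_lt0 ltr1n.
Qed.
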